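(* In the setting and notation of the context, assume the classic scaling $n=\alpha/\epsilon^d$ for a fixed $\alpha\in(0,1)$. Conditioned on the event $\lVert\boldsymbol\rho^{(n)}(0)\rVert_{\mathrm{TV}}=\lVert\rho_0\rVert_{L^1(\mathbb{T}^d)}$, for every $\phi\in C^\infty(\mathbb{T}^d\times\{1,\dots,d\}\times\{+,-\})$ the real-valued process $t\mapsto\langle\phi,C^{(n)}(t)\rangle$ is exponentially tight in $D(0,T)$ with speed $$\frac{\epsilon^dn^2}{\epsilon^2}=\frac{\alpha^2}{\epsilon^{d+2}}=\alpha^{1-2/d}n^{1+2/d}.$$
   Context: Fix $d\in\mathbb{N}$ and $T>0$. Let $\mathbb{T}^d=\mathbb{R}^d/\mathbb{Z}^d$. For each $n\in\mathbb{N}$ let $\epsilon=\epsilon_n\to0$ with $1/\epsilon\in\mathbb{N}$, and $\mathbb{T}_\epsilon^d=(\epsilon\mathbb{Z}/\mathbb{Z})^d$; $\mathds 1_l$ is the $l$-th unit vector; $x\sim y$ means $y=x\pm\epsilon\mathds1_l$ for some $l$ and sign. Dynamics: $(\eta(t),\widetilde W(t),\widetilde C(t))$ is the continuous-time Markov process with $\eta(t)\in\{0,1\}^{\mathbb{T}_\epsilon^d}$, $\widetilde W(t),\widetilde C(t)\in\mathbb{N}_0^{\mathbb{T}_\epsilon^d\times\mathbb{T}_\epsilon^d}$ such that for each ordered pair $(x,y)$ with $x\sim y$: at rate $\epsilon^{-2}\eta(x)(1-\eta(y))$ the particle at $x$ jumps to $y$ and $\widetilde W_{xy}$ increases by $1$;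 at rate $\epsilon^{-2}\eta(x)\eta(y)$, $\widetilde C_{xy}$ increases by $1$ ($\eta$ unchanged). Initial condition: $\rho_0\in C(\mathbb{T}^d)$ nonnegative; $\eta(x,0)$ independent Bernoulli with parameter $n\int_{B_\epsilon(x)}\rho_0\le1$, $B_\epsilon(x)=\prod_i[x_i-\epsilon/2,x_i+\epsilon/2]$; $\widetilde W(0)=\widetilde C(0)=0$. Empirical measure: $\boldsymbol\rho^{(n)}(t)=\frac1n\sum_{x}\eta(x,t)\delta_x$; $\lVert\cdot\rVert_{\mathrm{TV}}$ is total variation. Unidirectional collision number: $C^{(n)}_{l,\pm}(t)=\frac{\epsilon^2}{\epsilon^dn^2}\sum_{x}\widetilde C_{x,x\pm\epsilon\mathds1_l}(t)\,\delta_{x\pm\frac\epsilon2\mathds1_l}$, with $\langle\phi,C^{(n)}(t)\rangle=\sum_l\sum_\pm\int\phi_{l,\pm}\,dC^{(n)}_{l,\pm}(t)$. $D(0,T)$ is the space of real càdlàg paths with the Skorohod $J_1$ topology. A sequence $X^n$ is exponentially tight with speed $\beta_n\to\infty$ if for every $a>0$ there is a compact $K\subset D(0,T)$ with $\limsup_n\beta_n^{-1}\log\mathbb P(X^n\notin K)\le -a$. *)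

(* Defs.v *)
From HB Require Import structures.
From mathcomp Require Import all_boot all_order all_algebra.
From mathcomp Require Import all_classical all_reals all_analysis.

Set Implicit Arguments.
Unset Strict Implicit.
Unset Printing Implicit Defensive.

Import Order.TTheory GRing.Theory Num.Theory.
Import numFieldNormedType.Exports.
Local Open Scope classical_set_scope.
Local Open Scope ring_scope.

Section Defs.
Variable R : realType.

(* Functions on the torus T^d = R^d / Z^d, seen as Z^d-Zd_periodic        *)
(* functions on R^d = 'rV[R]_d.                                        *)
Definition Zd_periodic (d : nat) (f : 'rV[R]_d -> R) : Prop :=
  forall (x : 'rV[R]_d) (z : 'I_d -> int), f (x + \row_i (z i)%:~R) = f x.

Definition unitv (d : nat) (i : 'I_d) : 'rV[R]_d := \row_j (i == j)%:R.

Fixpoint iter_partial (d : nat) (s : seq 'I_d) (f : 'rV[R]_d -> R) : 'rV[R]_d -> R :=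
  match s with
  | [::] => f
  | i :: s' => 'D_(unitv i) (iter_partial s' f)
  end.

Definition smooth (d : nat) (f : 'rV[R]_d -> R) : Prop :=
  forall s : seq 'I_d, continuous (iter_partial s f) /\
    forall (x : 'rV[R]_d) (i : 'I_d), derivable (iter_partial s f) x (unitv i).

(* iterated (Lebesgue) integral over the box prod_{j<k} [a j, b j], the
   remaining coordinates being taken from v; used for continuous integrands *)
Definition upd (d : nat) (v : 'rV[R]_d) (j : nat) (t : R) : 'rV[R]_d :=
  \row_i (if (i : nat) == j then t else v ord0 i).

Fixpoint iint (d : nat) (k : nat) (a b : nat -> R) (f : 'rV[R]_d -> R)
    (v : 'rV[R]_d) : R :=
  match k with
  | 0 => f v
  | k'.+1 => Rintegral lebesgue_measure `[a k', b k']
               (fun t => iint k' a b f (upd v k' t))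
  end.

Definition box_integral (d : nat) (a b : nat -> R) (f : 'rV[R]_d -> R) : R :=
  iint d a b f 0.

Definition L1_torus (d : nat) (f : 'rV[R]_d -> R) : R :=
  box_integral (fun _ => 0) (fun _ => 1) (fun x => `|f x|).

(* The discrete torus T_eps^d, eps = 1/N                                *)
Definition site (N d : nat) := {ffun 'I_d -> 'I_N}.

Definition pos (N d : nat) (x : site N d) : 'rV[R]_d :=
  \row_i ((x i)%:R / N%:R).

(* x +/- eps 1_l  (s = true for +, false for -) *)
Definition lattice_shift (N d : nat) (x : site N d) (l : 'I_d) (s : bool) : site N d :=
  [ffun i => if i == l then (if s then ordS (x i) else ord_pred (x i)) else x i].

Definition nbr (N d : nat) (x y : site N d) : bool :=
  [exists l : 'I_d, exists s : bool, y == lattice_shift x l s].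

Definition Edges (N d : nat) : {set site N d * site N d} :=
  [set p | nbr p.1 p.2].

Definition bern_param (N d : nat) (n : R) (rho0 : 'rV[R]_d -> R) (x : site N d) : R :=
  n * box_integral (fun j => oapp (fun i : 'I_d => pos x ord0 i) 0 (insub j) - (N%:R)^-1 / 2)
                   (fun j => oapp (fun i : 'I_d => pos x ord0 i) 0 (insub j) + (N%:R)^-1 / 2)
                   rho0.

Record state (N d : nat) := State {
  st_eta : site N d -> bool;
  st_W : site N d * site N d -> nat;
  st_C : site N d * site N d -> nat }.

Definition step (N d : nat) (s : state N d) (p : site N d * site N d) : state N d :=
  let: (x, y) := p in
  let eta := st_eta s in
  if eta x && ~~ eta y then
    State (fun z => if z == x then false else if z == y then true else eta z)
          (fun q => if q == p then (st_W s q).+1 else st_W s q)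
          (st_C s)
  else if eta x && eta y then
    State eta (st_W s)
          (fun q => if q == p then (st_C s q).+1 else st_C s q)
  else s.

(* Uniformized (graphical) construction of the Markov process:
   a Poisson clock of total rate Lambda = eps^-2 * #|Edges|, with
   interarrival times tau j; at the j-th ring an ordered pair U j is
   chosen uniformly among the #|Edges| pairs and step is applied.
   Each ordered pair (x,y), x ~ y, thus rings at rate eps^-2, producing
   a jump at rate eps^-2 eta(x)(1-eta(y)) and a collision at rate
   eps^-2 eta(x)eta(y). *)
Definition rate_total (N d : nat) : R := (N%:R) ^+ 2 * #|Edges N d|%:R.

Section Path.
Variables (N d : nat) (Omega : Type).
Variables (eta0 : Omega -> site N d -> bool) (tau : nat -> Omega -> R)
          (U : nat -> Omega -> site N d * site N d).

Definition init_state (w : Omega) : state N d :=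
  State (eta0 w) (fun _ => 0%N) (fun _ => 0%N).

Fixpoint chain (w : Omega) (k : nat) : state N d :=
  match k with
  | 0 => init_state w
  | k'.+1 => step (chain w k') (U k' w)
  end.

Definition jump_time (w : Omega) (k : nat) : R := \sum_(j < k) tau j w.

(* state at time t: chain at the number of rings in (0,t] *)
Definition state_at (w : Omega) (t : R) : state N d :=
  match pselect (exists k, t < jump_time w k.+1) with
  | left h => chain w (ex_minn (P := fun k => t < jump_time w k.+1) h)
  | right _ => chain w 0
  end.

Definition collision_pairing (n : R)
    (phi : 'I_d -> bool -> 'rV[R]_d -> R) (w : Omega) (t : R) : R :=
  let eps := (N%:R)^-1 in
  \sum_(l < d) \sum_(s : bool) \sum_(x : site N d)
     (eps ^+ 2 / (eps ^+ d * n ^+ 2)) * (st_C (state_at w t) (x, lattice_shift x l s))%:R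
     * phi l s (pos x + (if s then 1 else -1) * (eps / 2) *: unitv l).

(* || rho^(n)(0) ||_TV  for rho^(n)(0) = 1/n sum_x eta(x,0) delta_x *)
Definition empirical_TV (n : R) (w : Omega) : R :=
  \sum_(x : site N d) `| n^-1 * (eta0 w x)%:R |.

End Path.

Definition indices (N d : nat) : eqType := ((site N d + nat) + nat)%type.

Section Model.
Variables (N d : nat) (dO : measure_display) (Omega : measurableType dO).
Variable (P : probability Omega R).
Variables (eta0 : Omega -> site N d -> bool) (tau : nat -> Omega -> R)
          (U : nat -> Omega -> site N d * site N d).

Definition gen_events (i : indices N d) (A : set Omega) : Prop :=
  match i with
  | inl (inl x) => exists B : set bool, A = (fun w => eta0 w x) @^-1` B
  | inl (inr j) => exists2 B : set R, measurable B & A = tau j @^-1` B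
  | inr j => exists B : set (site N d * site N d), A = U j @^-1` B
  end.

Definition mutually_independent : Prop :=
  forall (s : seq (indices N d)) (A : indices N d -> set Omega),
    uniq s -> (forall i, i \in s -> gen_events i (A i)) ->
    P (\big[setI/setT]_(i <- s) A i) = (\prod_(i <- s) P (A i))%E.

Definition is_model (n : R) (rho0 : 'rV[R]_d -> R) : Prop :=
  [/\
      (forall i A, gen_events i A -> measurable A),
      (forall x (B : set bool),
          P ((fun w => eta0 w x) @^-1` B) = bernoulli_prob (bern_param n rho0 x) B),
      (forall j (B : set R), measurable B ->
          P (tau j @^-1` B) = exponential_prob (rate_total N d) B),
      (forall j p, P (U j @^-1` [set p]) =
          (if p \in Edges N d then (#|Edges N d|%:R)^-1 else 0)%:E)
    & mutually_independent].

(* conditional probability given E (0 if P E = 0) *)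
Definition cond_prob (E A : set Omega) : \bar R :=
  (fine (P (A `&` E)) / fine (P E))%:E.

End Model.

Section Skorohod.
Variable T : R.

Definition cadlag (f : R -> R) : Prop :=
  (forall t, 0 <= t < T -> f x @[x --> t^'+] --> f t) /\
  (forall t, 0 < t <= T -> cvg (f x @[x --> t^'-])).

Definition Dspace : set (R -> R) := [set f | cadlag f].

Definition time_changes : set (R -> R) :=
  [set lam | [/\ lam 0 = 0, lam T = T, {within `[0, T], continuous lam} &
              forall s t, 0 <= s -> s < t -> t <= T -> lam s < lam t]].

Definition J1dist (f g : R -> R) : R :=
  inf [set Num.max (sup [set `|lam t - t| | t in `[0, T]])
                   (sup [set `|f t - g (lam t)| | t in `[0, T]])
      | lam in time_changes].

Definition J1open (O : set (R -> R)) : Prop :=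
  O `<=` Dspace /\
  forall f, O f -> exists2 r : R, 0 < r &
    forall g, Dspace g -> J1dist f g < r -> O g.

Definition J1compact (K : set (R -> R)) : Prop :=
  K `<=` Dspace /\
  forall (I : Type) (O : I -> set (R -> R)),
    (forall i, J1open (O i)) -> K `<=` \bigcup_i O i ->
    exists (m : nat) (g : 'I_m -> I), K `<=` \bigcup_(j in [set: 'I_m]) O (g j).

End Skorohod.

Definition elog (x : \bar R) : \bar R :=
  if x == 0%E then -oo%E else (ln (fine x))%:E.

End Defs.

(* Main.v *)
Require Import Defs.
From HB Require Import structures.
From mathcomp Require Import all_boot all_order all_algebra.
From mathcomp Require Import all_classical all_reals all_analysis.
From mathcomp Require Import measurable_realfun.
From mathcomp Require Import ring lra zify.
Import Order.TTheory GRing.Theory Num.Theory.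
Import numFieldNormedType.Exports.
Local Open Scope classical_set_scope.
Local Open Scope ring_scope.

(**
Let [s] be the speed. The pairing moves by at most [c / s] at each ring of the
clock, and the clock rings at rate at most [C * s], so an oscillation [e] within
a time window forces about [e * s / c] consecutive small waiting times, which
is super-exponentially unlikely at speed [s] once the window is short. The
initial configuration enters only through the conditioning event, which is
independent of the waiting times; hence no lower bound on its probability is
needed, and the estimate holds for every index, not just in the limit.

The compact set consists of the bounded right-continuous paths whose three-point
Skorohod modulus (with its two endpoint conditions) is at most [1 / (j + 1)] at
scale [del j], for all [j]. Its compactness follows from taking a pointwise
limit along an ultrafilter and regularising it from the right. Since the modulus
of a right-continuous path is determined by countably many times, the event that
the path lies in this set is measurable.
*)

Set Implicit Arguments.
Unset Strict Implicit.

(** * The three-point modulus and local time changes *)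

(** Whatever the speed, the jump size [c / s] exceeds [eps j] for all large [j], and at those levels
    a single ring breaks any modulus of continuity. The three-point condition tolerates isolated
    large jumps; only the condition at [T] then asks that no ring falls just before [T].

    This costs a probability merely linear in [del j]. It is needed only when [s < c / eps j], where
    [expR (- (a * s))] is bounded below, so a small [del j] settles it. For the windows, [L] small
    waiting times cost [(2 * p) ^ L] with [L] at least proportional to [s], and [p] is made as small
    as desired by shrinking the time scale; the number of starting positions grows only linearly in
    [s]. Since [del j] is chosen before [s], and the levels carry weights of order [2 ^ - j], one
    compact set serves all indices. *)

Ltac clear_lra :=
  repeat match goal with H : forall _, _ |- _ => clear H end; lra.

Ltac norm_lra :=
  repeat match goal with H : forall _, _ |- _ => clear H end;
  repeat match goal with
  | H : is_true (`|_| <= _) |- _ => move: H; rewrite ler_norml => /andP[? ?]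
  | H : is_true (`|_| < _) |- _ => move: H; rewrite ltr_norml => /andP[? ?]
  | H : is_true (_ < `|_|) |- _ => move: H; rewrite ltr_normr => /orP[?|?]
  end;
  rewrite ?ler_norml ?ltr_norml; try (apply/andP; split); lra.

(** A violated non-strict bound is violated strictly, which leaves room for errors [e] at both
    points; this is how moduli pass to limits. *)
Lemma far_perturbation (R : realType) (a b a' b' eps e : R) :
  `|a' - a| <= e -> `|b' - b| <= e -> eps + 2 * e < `|a - b| ->
  ~ (`|a' - b'| <= eps).
Proof. move=> ? ? ? ?; norm_lra. Qed.

Section SkorohodModulus.
Variables (R : realType) (T : R).
Implicit Types (f g : R -> R) (eps dl s t u x y h : R).

Definition right_continuous_lt f : Prop :=
  forall t, 0 <= t < T -> forall eps, 0 < eps ->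
  exists2 h, 0 < h & forall x, t < x < t + h -> `|f x - f t| <= eps.

Definition three_point f eps dl : Prop :=
  forall s t u, 0 <= s -> s < t -> t < u -> u <= T -> u - s < dl ->
  `|f t - f s| <= eps \/ `|f u - f t| <= eps.

(** The endpoint conditions stop jumps from escaping to 0 or [T], which time changes fix: unit steps
    at time [1 / n] satisfy the three-point condition but have no convergent subsequence. *)
Definition modulus_le f eps dl : Prop :=
  [/\ forall t, 0 <= t <= T -> t < dl -> `|f t - f 0| <= eps,
      forall t, 0 <= t <= T -> T - dl < t -> `|f T - f t| <= eps &
      three_point f eps dl].

Definition modulus_on (D : set R) f eps dl : Prop :=
  [/\ forall t, D t -> 0 <= t <= T -> t < dl -> `|f t - f 0| <= eps,
      forall t, D t -> 0 <= t <= T -> T - dl < t -> `|f T - f t| <= eps &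
      forall s t u, D s -> D t -> D u -> 0 <= s -> s < t -> t < u -> u <= T ->
        u - s < dl -> `|f t - f s| <= eps \/ `|f u - f t| <= eps].

Lemma modulus_le_on (D : set R) f eps dl : modulus_le f eps dl -> modulus_on D f eps dl.
Proof.
move=> [f1 f2 f3]; split.
- by move=> t _; exact: f1.
- by move=> t _; exact: f2.
- by move=> s t u _ _ _; exact: f3.
Qed.

(** Used with [f = g] a path and [D] countable, for measurability, and with [D = setT] and [f] the
    right regularisation of [g], for compactness. *)
Lemma modulus_on_approx (D : set R) g f eps dl :
  f 0 = g 0 -> f T = g T ->
  (forall t, 0 <= t <= T -> forall e, 0 < e -> forall B, t < B ->
    exists t', [/\ D t', t <= t' < B, t' <= T & `|g t' - f t| <= e]) ->
  modulus_on D g eps dl -> modulus_le f eps dl.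
Proof.
move=> f0 fT fP [g1 g2 g3]; split.
- move=> t tT td; rewrite f0; apply/ler_addgt0Pr => e e0.
  have [t' [Dt' /andP[? ?] ? ?]] := fP t tT e e0 _ td.
  move/andP: tT => [t0 tT].
  have := g1 t' Dt' ltac:(apply/andP; split; clear_lra) ltac:(clear_lra) => ?.
  by norm_lra.
- move=> t tT td; rewrite fT; apply/ler_addgt0Pr => e e0.
  have [t' [Dt' /andP[? ?] ? ?]] := fP t tT e e0 (t + 1) ltac:(clear_lra).
  move/andP: tT => [t0 tT].
  have := g2 t' Dt' ltac:(apply/andP; split; clear_lra) ltac:(clear_lra) => ?.
  by norm_lra.
- move=> s t u s0 st tu uT us.
  have [E1|E1] := leP (`|f t - f s|) eps; first by left.
  have [E2|E2] := leP (`|f u - f t|) eps; first by right.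
  exfalso.
  have sT : 0 <= s <= T by apply/andP; split; clear_lra.
  have tT : 0 <= t <= T by apply/andP; split; clear_lra.
  have uT' : 0 <= u <= T by apply/andP; split; clear_lra.
  pose e := Num.min ((`|f t - f s| - eps) / 3) ((`|f u - f t| - eps) / 3).
  have e0 : 0 < e by rewrite /e lt_min; apply/andP; split; clear_lra.
  have [e1 e2] : e <= (`|f t - f s| - eps) / 3 /\ e <= (`|f u - f t| - eps) / 3.
    by rewrite /e !ge_min !lexx orbT.
  have Ee1 : eps + 2 * e < `|f t - f s| by clear_lra.
  have Ee2 : eps + 2 * e < `|f u - f t| by clear_lra.
  move: e1 e2 => _ _.
  have [s' [Ds' /andP[ss' s't] s'T cs]] := fP s sT e e0 t st.
  have [t' [Dt' /andP[tt' t'u] t'T ct]] := fP t tT e e0 u tu.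
  have [u' [Du' /andP[uu' u's] u'T cu]] := fP u uT' e e0 (s + dl) ltac:(clear_lra).
  have us' : u' - s' < dl by clear - ss' u's; clear_lra.
  case: (g3 s' t' u' Ds' Dt' Du' (le_trans s0 ss') (lt_le_trans s't tt')
    (lt_le_trans t'u uu') u'T us').
    exact: far_perturbation Ee1.
  exact: far_perturbation Ee2.
Qed.

(** Left limits come from the three-point conditions, once [eps] takes arbitrarily small values and
    every [del j] is positive. *)
Definition modulus_set (M : R) (eps del : nat -> R) : set (R -> R) :=
  [set f | [/\ right_continuous_lt f, forall t, 0 <= t <= T -> `|f t| <= M &
               forall j, modulus_le f (eps j) (del j)]].

(** Either no increment in the window exceeds [eps], or one does, from [x] to [y]; then the
    three-point condition at [z < x < y] keeps every [z] in []t, x[] within [eps] of [g x]. *)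
Lemma three_point_osc_right g eps dl t : three_point g eps dl -> 0 < dl ->
  0 <= t < T -> exists2 h, 0 < h <= T - t &
    forall x y, t < x < t + h -> t < y < t + h -> `|g x - g y| <= 2 * eps.
Proof.
move=> g3 dl0 /andP[t0 tT].
pose h := Num.min dl (T - t).
have h0 : 0 < h by rewrite lt_min dl0 subr_gt0.
have [hd hT] : h <= dl /\ h <= T - t by rewrite !ge_min !lexx orbT.
have [[x [y [tx xy yh xyE]]]|H] := pselect (exists x y,
    [/\ t < x, x < y, y < t + h & eps < `|g y - g x|]).
- exists (x - t); first by apply/andP; split; clear_lra.
  have close z : t < z < t + (x - t) -> `|g x - g z| <= eps.
    move=> /andP[tz zx]; have [|||||//|] := g3 z x y; try clear_lra.
  move=> z z' /close zc /close z'c; norm_lra.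
- exists h; first by rewrite h0 hT.
  have close x y : t < x -> y < t + h -> x < y -> `|g y - g x| <= eps.
    by move=> tx yh xy; rewrite leNgt; apply/negP => E; apply: H; exists x, y.
  move=> x y /andP[tx xh] /andP[ty yh].
  have [xy|yx|->] := ltgtP x y.
  + have := close x y tx yh xy; have := normr_ge0 (g y - g x) => ? ?.
    have : 0 <= eps by clear_lra.
    by move=> ?; norm_lra.
  + have := close y x ty xh yx; have := normr_ge0 (g x - g y) => ? ?.
    by clear_lra.
  + rewrite subrr normr0.
    have ty2 : y < (y + (t + h)) / 2 by clear_lra.
    have := close y ((y + (t + h)) / 2) ty ltac:(clear_lra) ty2.
    by have := normr_ge0 (g ((y + (t + h)) / 2) - g y); clear_lra.
Qed.

Lemma three_point_osc_left g eps dl t : three_point g eps dl -> 0 < dl ->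
  0 < t <= T -> exists2 h, 0 < h <= t &
    forall x y, t - h < x < t -> t - h < y < t -> `|g x - g y| <= 2 * eps.
Proof.
move=> g3 dl0 /andP[t0 tT].
have r3 : three_point (fun x => g (T - x)) eps dl.
  move=> a b c a0 ab bc cT cad.
  by have [|||||?|?] := g3 (T - c) (T - b) (T - a); try clear_lra;
    [right|left]; rewrite distrC.
have [|h /andP[h0 hT] H] := @three_point_osc_right _ eps dl (T - t) r3 dl0.
  by apply/andP; split; clear_lra.
exists h; first by apply/andP; split; clear_lra.
move=> x y /andP[? ?] /andP[? ?].
have := H (T - x) (T - y); rewrite !subKr; apply; apply/andP; split; clear_lra.
Qed.

Lemma J1dist_le f g lam (c : R) : 0 <= c -> 0 <= T -> time_changes T lam ->
  (forall t, 0 <= t <= T -> `|lam t - t| <= c) ->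
  (forall t, 0 <= t <= T -> `|f t - g (lam t)| <= c) ->
  J1dist T f g <= c.
Proof.
move=> c0 T0 lamT H1 H2.
have supc (p : R -> R) : (forall t, 0 <= t <= T -> `|p t| <= c) ->
    sup [set `|p t| | t in `[0, T]] <= c.
  move=> pc; apply: ge_sup; first by exists `|p 0|, 0 => //=; rewrite in_itv/= lexx.
  by move=> _ [t /= + <-]; rewrite in_itv/=; exact: pc.
(* The library gives [sup] the value 0 on a set without supremum, so no bound on [p] is required;
   the lower bound demanded by [ge_inf] rests on this. *)
have sup0 (p : R -> R) : 0 <= sup [set `|p t| | t in `[0, T]].
  have [[[x Ax] ub]|/sup_out ->//] := pselect (has_sup [set `|p t| | t in `[0, T]]).
  apply: le_trans (ub_le_sup ub Ax); by case: Ax => t _ <-.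
apply: le_trans (_ : Num.max _ _ <= c).
  apply: ge_inf; last by exists lam.
  by exists 0 => _ [l _ <-]; rewrite le_max sup0.
by rewrite ge_max !supc.
Qed.

(* A time change of [a, b] fixing both endpoints, so that such pieces can be glued. *)
Definition matched f0 f h eps a b : Prop := exists lam : R -> R,
  [/\ lam a = a, lam b = b, {within `[a, b], continuous lam},
      forall x y, a <= x -> x < y -> y <= b -> lam x < lam y &
      forall x, a <= x <= b -> `|lam x - x| <= h /\ `|f0 x - f (lam x)| <= eps].

Lemma glue_increasing (l1 l2 : R -> R) a b c : a < b -> b < c -> l1 b = l2 b ->
  {within `[a, b], continuous l1} -> {within `[b, c], continuous l2} ->
  (forall x y, a <= x -> x < y -> y <= b -> l1 x < l1 y) ->
  (forall x y, b <= x -> x < y -> y <= c -> l2 x < l2 y) ->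
  let l := fun x => if x <= b then l1 x else l2 x in
  {within `[a, c], continuous l} /\
  forall x y, a <= x -> x < y -> y <= c -> l x < l y.
Proof.
move=> ab bc l12 l1c l2c l1i l2i l; split.
- suff -> : `[a, c]%classic = `[a, b] `|` `[b, c] :> set R.
    apply: withinU_continuous; try exact: interval_closed.
    + apply: subspace_eq_continuous l1c => x /=; rewrite inE/= in_itv/= => /andP[_ xb].
      by rewrite /from_subspace /l xb.
    + apply: subspace_eq_continuous l2c => x /=; rewrite inE/= in_itv/= => /andP[bx _].
      rewrite /from_subspace /l; case: (leP x b) => // xb.
      by have -> : x = b by apply: le_anti; rewrite xb bx.
  apply/seteqP; split => x /=; rewrite !in_itv/=.
    by move=> /andP[ax xc]; case: (leP x b) => xb; [left|right];
      rewrite ?ax ?xb ?xc ?(ltW xb).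
  move=> [/andP[ax xb]|/andP[bx xc]]; apply/andP; split; clear_lra.
- move=> x y ax xy yc; rewrite /l; case: (leP x b) => xb; case: (leP y b) => yb.
  + exact: l1i.
  + have H1 : l1 x <= l1 b.
      have [xb'|bx|->] := ltgtP x b; [|clear_lra|by []].
      by apply/ltW/l1i.
    by apply: le_lt_trans H1 _; rewrite l12 l2i.
  + clear_lra.
  + by apply: l2i => //; exact: ltW.
Qed.

Lemma matched_trans f0 f h eps a b c : a < b -> b < c ->
  matched f0 f h eps a b -> matched f0 f h eps b c -> matched f0 f h eps a c.
Proof.
move=> ab bc [l1 [l1a l1b l1c l1i l1m]] [l2 [l2b l2c l2co l2i l2m]].
have [] := @glue_increasing l1 l2 a b c ab bc _ l1c l2co l1i l2i.
  by rewrite l1b l2b.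
set l := fun x => _ => lc li; exists l; split => //.
- by rewrite /l ltW.
- by rewrite /l leNgt bc.
- move=> x /andP[ax xc]; rewrite /l; case: (leP x b) => xb; [apply: l1m|apply: l2m].
    by rewrite ax xb.
  by rewrite xc ltW.
Qed.

Lemma matched_id f0 f h eps a b : 0 <= h ->
  (forall x, a <= x <= b -> `|f0 x - f x| <= eps) -> matched f0 f h eps a b.
Proof.
move=> h0 H; exists id; split => //.
  by apply: continuous_subspaceT => x; exact: cvg_id.
by move=> x xab; split; [rewrite subrr normr0|exact: H].
Qed.

(* If f a and f b are far apart, the three-point condition makes f leave the
   neighbourhood of f a exactly once; the time change sends t to that instant.
   The extra point b' keeps this instant away from b. *)
Lemma matched_switch f0 f h eps dl a t b' b :
  0 <= a -> a < t -> t < b' -> b' < b -> b <= T -> b - a < dl -> b - a <= h ->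
  0 < eps -> right_continuous_lt f -> three_point f eps dl ->
  (forall x, a <= x < t -> `|f0 x - f0 a| <= eps) ->
  (forall x, t <= x <= b -> `|f0 x - f0 b| <= eps) ->
  `|f a - f0 a| <= 2 * eps -> `|f b - f0 b| <= 2 * eps ->
  `|f b' - f0 b'| <= 2 * eps -> matched f0 f h (10 * eps) a b.
Proof.
move=> a0 a_t tb' b'b bT bad bah e0 frc f3 f0a f0b fa fb fb'.
have AB x : a <= x <= b -> `|f x - f a| <= eps \/ `|f b - f x| <= eps.
  move=> /andP[ax xb].
  have [->|xa] := eqVneq x a; first by left; rewrite subrr normr0 ltW.
  have [->|xb'] := eqVneq x b; first by right; rewrite subrr normr0 ltW.
  by apply: f3 => //; rewrite lt_neqAle ?ax ?xb ?(eq_sym a) ?xa ?xb'.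
have f0AB x : a <= x <= b -> `|f0 x - f0 a| <= eps \/ `|f0 x - f0 b| <= eps.
  by move=> /andP[ax xb]; have [xt|tx] := ltP x t; [left; apply: f0a|right; apply: f0b];
    apply/andP; split.
(* If the two levels are this close, the identity matches with error at most
   [(1 + 2 + 6 + 1) * eps], whence the factor 10. *)
have [fab|fab] := leP `|f a - f b| (6 * eps).
  apply: matched_id; first clear_lra.
  move=> x xab; case: (AB x xab) => ?; case: (f0AB x xab) => ?; norm_lra.
(* [f b'] is within [(2 + 1 + 2) * eps] of [f b]; being also within [eps] of [f a] would contradict
   the gap, which explains the threshold 6. *)
have b'B : `|f b - f b'| <= eps.
  have [|?|//] := AB b'; first by apply/andP; split; clear_lra.
  have := f0b b' ltac:(apply/andP; split; clear_lra) => ?.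
  by exfalso; norm_lra.
pose B := [set x | a <= x <= b /\ `|f b - f x| <= eps].
(* A return to the neighbourhood of [f a] would make two large increments within one window. *)
have Bup x y : B x -> x < y -> y <= b -> B y.
  move=> [/andP[ax xb] Bx] xy yb.
  have ayb : a <= y <= b by apply/andP; split; clear_lra.
  split => //; have [Ay|//] := AB y ayb.
  have ax' : a < x.
    rewrite lt_neqAle ax andbT; apply/eqP => xa; move: Bx; rewrite -xa => H.
    by clear - H fab e0; norm_lra.
  have yad : y - a < dl by clear - yb bad; clear_lra.
  exfalso; case: (f3 a x y a0 ax' xy (le_trans yb bT) yad) => H.
    by clear - H Bx fab e0; norm_lra.
  by clear - H Ay Bx fab e0; norm_lra.
have Bb' : B b' by split => //; apply/andP; split; clear_lra.
have Blb : has_lbound B by exists a => x [/andP[]].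
pose sg := inf B.
have sgb' : sg <= b' by exact: ge_inf.
have asg0 : a <= sg by apply: lb_le_inf; [exists b'|move=> x [/andP[]]].
have [h1 h10 h1f] := frc a ltac:(apply/andP; split; clear_lra) eps e0.
(* Right continuity keeps [f] near [f a] for a while, so the first affine piece below has positive
   slope. *)
have asg : a < sg.
  apply: (@lt_le_trans _ _ (a + h1)); first by clear_lra.
  apply: lb_le_inf; [by exists b'|move=> x [/andP[ax xb] Bx]].
  rewrite leNgt; apply/negP => xh.
  have [xa|ax'] : x = a \/ a < x by move: ax; rewrite le_eqVlt => /orP[/eqP|]; auto.
    by move: Bx; rewrite xa => H; clear - H fab e0; norm_lra.
  by have := h1f x; rewrite ax' xh => /(_ isT) H; clear - H Bx fab e0; norm_lra.
have ltA x : a <= x -> x < sg -> `|f x - f a| <= eps.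
  move=> ax xs; have [|//|Bx] := AB x; first by apply/andP; split; clear_lra.
  suff : sg <= x by rewrite leNgt xs.
  apply: ge_inf => //; split => //; clear - ax xs sgb' b'b.
  by apply/andP; split; clear_lra.
have gtB x : sg < x -> x <= b -> `|f b - f x| <= eps.
  move=> sx xb; have [y By yx] := inf_lt (ex_intro _ b' Bb') sx.
  by case: (Bup y x By yx xb).
(* Right continuity puts the instant [sg] on the side of [f b], just as [t] is on the side of
   [f0 b]. *)
have sgB : `|f b - f sg| <= eps.
  apply/ler_addgt0Pr => e' e'0.
  have [h2 h20 h2f] := frc sg ltac:(apply/andP; split; clear_lra) e' e'0.
  pose x := Num.min b (sg + h2 / 2).
  have [xb xs] : x <= b /\ x <= sg + h2 / 2 by rewrite !ge_min !lexx orbT.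
  have sx : sg < x by rewrite lt_min; apply/andP; split; clear_lra.
  have := h2f x ltac:(clear - sx xs h20; apply/andP; split; clear_lra) => H1.
  by have := gtB x sx xb => H2; clear - H1 H2; norm_lra.
have ta0 : 0 < t - a by clear_lra.
have bt0 : 0 < b - t by clear_lra.
(* The two affine pieces send [a], [t], [b] to [a], [sg], [b]. *)
pose l1 x := a + (x - a) * ((sg - a) / (t - a)).
pose l2 x := b - (b - x) * ((b - sg) / (b - t)).
have k10 : 0 < (sg - a) / (t - a) by apply: divr_gt0 => //; clear_lra.
have k20 : 0 < (b - sg) / (b - t) by apply: divr_gt0 => //; clear_lra.
have l1a : l1 a = a by rewrite /l1 subrr mul0r addr0.
have l2b : l2 b = b by rewrite /l2 subrr mul0r subr0.
have l1t : l1 t = sg by rewrite /l1 mulrC divfK ?lt0r_neq0// addrC subrK.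
have l2t : l2 t = sg by rewrite /l2 mulrC divfK ?lt0r_neq0//; ring.
have l1i x y : x < y -> l1 x < l1 y.
  by move=> xy; rewrite /l1 ltrD2l ltr_pM2r// ltrD2r.
have l2i x y : x < y -> l2 x < l2 y.
  by move=> xy; rewrite /l2 ltrD2l ltrN2 ltr_pM2r// ltrD2l ltrN2.
have tb : t < b by clear_lra.
have [] := @glue_increasing l1 l2 a t b a_t tb.
- by rewrite l1t l2t.
- apply: continuous_subspaceT => x; apply: cvgD; first exact: cvg_cst.
  by apply: cvgMl; apply: cvgB; [exact: cvg_id|exact: cvg_cst].
- apply: continuous_subspaceT => x; apply: cvgB; first exact: cvg_cst.
  by apply: cvgMl; apply: cvgB; [exact: cvg_cst|exact: cvg_id].
- by move=> x y _ + _; exact: l1i.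
- by move=> x y _ + _; exact: l2i.
set l := fun x => _ => lc li'.
have li x y : a <= x -> x < y -> y <= b -> l x < l y by exact: li'.
have la : l a = a by rewrite /l ltW.
have lb : l b = b by rewrite /l leNgt tb.
exists l; split => // x /andP[ax xb].
have lxa : a <= l x.
  move: ax; rewrite le_eqVlt => /orP[/eqP<-|ax]; rewrite ?la//.
  by rewrite (le_trans _ (ltW (li _ _ (lexx a) ax xb)))// la.
have lxb : l x <= b.
  move: xb; rewrite le_eqVlt => /orP[/eqP->|xb]; rewrite ?lb//.
  by have := li x b ax xb (lexx b); rewrite lb => /ltW.
split; first by clear - lxa lxb ax xb bah; norm_lra.
have [xt|tx] := ltP x t.
  have := f0a x; rewrite ax xt => /(_ isT) H1.
  have := ltA (l x) lxa; rewrite {1}/l (ltW xt) -l1t => /(_ (l1i _ _ xt)) H2.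
  by clear - H1 H2 fa e0; norm_lra.
have := f0b x; rewrite tx xb => /(_ isT) H1.
have : `|f b - f (l x)| <= eps.
  move: tx; rewrite le_eqVlt => /orP[/eqP<-|tx]; first by rewrite /l lexx l1t.
  by apply: gtB => //; rewrite /l leNgt tx -l2t l2i.
by move=> H2; clear - H1 H2 fb e0; norm_lra.
Qed.

End SkorohodModulus.

(** * Compactness in the J1 topology *)

Section SkorohodCompactness.
Variables (R : realType) (T : R).
Implicit Types (f g : R -> R) (s t u x y h e : R).

Lemma cauchy_right_limit g t :
  (forall e, 0 < e -> exists2 h, 0 < h &
    forall x y, t < x < t + h -> t < y < t + h -> `|g x - g y| <= e) ->
  exists p, forall e, 0 < e -> exists2 h, 0 < h &
    forall x, t < x < t + h -> `|g x - p| <= e.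
Proof.
move=> gC.
have /cauchy_cvgP/cvg_ex[p gp] : cauchy (g x @[x --> t^'+]).
  apply: cauchy_exP => e e0; have [|h h0 H] := gC (e / 2); first clear_lra.
  exists (g (t + h / 2)); change (\forall x \near t^'+, ball (g (t + h / 2)) e (g x)).
  near=> x; rewrite /ball/=; apply: (@le_lt_trans _ _ (e / 2)); last clear_lra.
  apply: H; first by apply/andP; split; clear_lra.
  by apply/andP; split; near: x; [exact: nbhs_right_gt|apply: nbhs_right_lt; clear_lra].
exists p => e e0.
have /cvgrPdist_le/(_ e e0)[h /= h0 H] := gp.
exists h => // x /andP[tx xh]; rewrite distrC; apply: H => //.
by rewrite /ball/= ltr_norml; apply/andP; split; clear_lra.
Unshelve. all: by end_near. Qed.

Lemma cauchy_left_cvg g t :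
  (forall e, 0 < e -> exists2 h, 0 < h &
    forall x y, t - h < x < t -> t - h < y < t -> `|g x - g y| <= e) ->
  cvg (g x @[x --> t^'-]).
Proof.
move=> gC; apply/cauchy_cvgP; apply: cauchy_exP => e e0.
have [|h h0 H] := gC (e / 2); first clear_lra.
exists (g (t - h / 2)); change (\forall x \near t^'-, ball (g (t - h / 2)) e (g x)).
near=> x; rewrite /ball/=; apply: (@le_lt_trans _ _ (e / 2)); last clear_lra.
apply: H; first by apply/andP; split; clear_lra.
by apply/andP; split; near: x; [apply: nbhs_left_gt; clear_lra|exact: nbhs_left_lt].
Unshelve. all: by end_near. Qed.

Lemma ultra_pointwise_limit (G : set_system (R -> R)) t M :
  UltraFilter G -> G [set f | `|f t| <= M] ->
  exists p, forall e, 0 < e -> G [set f | `|f t - p| <= e].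
Proof.
move=> GU GM.
have ev_surj : (fun f : R -> R => f t) @` setT = setT.
  by apply/seteqP; split => // y _; exists (cst y).
have := @segment_compact R (- M) M; rewrite compact_ultra.
move=> /(_ _ (ultra_image GU ev_surj))[|p [_ Gp]].
  exists [set f | `|f t| <= M] => //; apply/seteqP; split => [_ [f /= fM <-]|y /=].
    by rewrite in_itv/= -ler_norml.
  by rewrite in_itv/= -ler_norml => yM; exists (cst y).
exists p => e e0.
have [A GA AE] := Gp (ball p e) (nbhsx_ballx p e e0).
apply: filterS GA => f Af; have : ball p e (f t) by rewrite -AE; exists f.
by rewrite /ball/= distrC => /ltW.
Qed.

(** Continuous induction: the supremum of the good points reachable from 0 cannot lie before [T],
    since a step from just below it lands beyond it. This stands in for a finite subdivision of
    [[0, T]] adapted to the limit path. *)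
Lemma interval_chain (good : R -> Prop) (Q : R -> R -> Prop) : 0 < T ->
  (forall a b c, a < b -> b < c -> Q a b -> Q b c -> Q a c) ->
  (exists b, [/\ 0 < b <= T, good b & Q 0 b]) ->
  (forall t, 0 < t -> t < T -> exists2 h, 0 < h &
    forall a, t - h < a -> a <= t -> 0 < a -> good a ->
    exists b, [/\ t < b, b <= T, good b & Q a b]) ->
  (exists2 h, 0 < h & forall a, T - h < a -> a < T -> 0 < a -> good a -> Q a T) ->
  Q 0 T.
Proof.
move=> T0 Qtrans [b0 [b00 gb0 Qb0]] step [hT hT0 Qlast].
pose S := [set b | [/\ 0 < b <= T, good b & Q 0 b]].
have Sb0 : S b0 by split.
have Sub : has_ubound S by exists T => x [/andP[]].
pose ts := sup S.
have tsT : ts <= T by apply: ge_sup; [exists b0|move=> x [/andP[]]].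
have ts0 : 0 < ts.
  by have /andP[b0p _] := b00; apply: lt_le_trans b0p _; exact: ub_le_sup.
have adh h : 0 < h -> exists a, [/\ S a, ts - h < a & a <= ts].
  move=> hp; have [a Sa la] := sup_adherent hp (conj (ex_intro _ b0 Sb0) Sub).
  by exists a; split => //; exact: ub_le_sup.
move: tsT; rewrite le_eqVlt => /orP[/eqP tsE|tsT].
  have [a [[/andP[a0 aT] ga Qa] la _]] := adh hT hT0.
  move: aT; rewrite le_eqVlt => /orP[/eqP<-//|aT].
  by apply: Qtrans Qa _ => //; apply: Qlast => //; rewrite -tsE.
have [h h0 H] := step ts ts0 tsT.
have [a [[/andP[a0 aT] ga Qa] la ats]] := adh h h0.
have [b [tsb bT gb Qab]] := H a la ats a0 ga.
suff : S b by move=> /(ub_le_sup Sub); rewrite leNgt tsb.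
by split => //; [rewrite bT (lt_trans ts0)|apply: Qtrans Qab => //; exact: le_lt_trans tsb].
Qed.

Variables (M : R) (eps del : nat -> R).

Local Notation K := (modulus_set T M eps del).

Lemma modulus_set_cadlag : (forall e, 0 < e -> exists j, eps j < e) ->
  (forall j, 0 < del j) -> K `<=` Dspace T.
Proof.
move=> eps0 del0 f [frc _ fm]; split => t tT.
  apply/cvgrPdist_le => e e0; have [h h0 H] := frc t tT e e0.
  near=> x; rewrite distrC; apply: H.
  by apply/andP; split; near: x; [exact: nbhs_right_gt|apply: nbhs_right_lt; clear_lra].
apply: cauchy_left_cvg => e e0.
have [|j je] := eps0 (e / 2); first clear_lra.
have [_ _ f3] := fm j.
have [h /andP[h0 _] H] := three_point_osc_left f3 (del0 j) tT.
exists h => // x y xh yh; apply: le_trans (H _ _ xh yh) _; clear_lra.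
Unshelve. all: by end_near. Qed.

(** * Pointwise limits along an ultrafilter and their regularisation *)

Section Limit.
Variable G : set_system (R -> R).
Variable g : R -> R.

Lemma limit_bound : UltraFilter G -> G K ->
  (forall t, 0 <= t <= T -> forall e, 0 < e -> G [set f | `|f t - g t| <= e]) ->
  forall t, 0 <= t <= T -> `|g t| <= M.
Proof.
move=> GU GK gP t tT; apply/ler_addgt0Pr => e e0.
have [f [[_ /(_ t tT) fM _] /= fg]] := filter_ex (filterI GK (gP _ tT _ e0)).
norm_lra.
Qed.

(** Each condition involves at most three times, so a single path of [K] close to [g] at these times
    transfers it. *)
Lemma limit_modulus : 0 < T -> UltraFilter G -> G K ->
  (forall t, 0 <= t <= T -> forall e, 0 < e -> G [set f | `|f t - g t| <= e]) ->
  forall j, modulus_le T g (eps j) (del j).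
Proof.
move=> T0 GU GK gP j.
have T0T : 0 <= (0 : R) <= T by rewrite lexx ltW.
have TTT : 0 <= T <= T by apply/andP; split; clear_lra.
split.
- move=> t tT tdl; rewrite leNgt; apply/negP => E.
  pose e := (`|g t - g 0| - eps j) / 3.
  have e0 : 0 < e by rewrite /e; clear_lra.
  have Ee : eps j + 2 * e < `|g t - g 0| by rewrite /e; clear_lra.
  have [f [[_ _ /(_ j)[+ _ _]] [/= ? ?]]] := filter_ex (filterI GK
    (filterI (gP _ tT _ e0) (gP _ T0T _ e0))).
  move=> /(_ t tT tdl) ?; norm_lra.
- move=> t tT tdl; rewrite leNgt; apply/negP => E.
  pose e := (`|g T - g t| - eps j) / 3.
  have e0 : 0 < e by rewrite /e; clear_lra.
  have Ee : eps j + 2 * e < `|g T - g t| by rewrite /e; clear_lra.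
  have [f [[_ _ /(_ j)[_ + _]] [/= ? ?]]] := filter_ex (filterI GK
    (filterI (gP _ tT _ e0) (gP _ TTT _ e0))).
  move=> /(_ t tT tdl) ?; norm_lra.
- move=> s t u s0 st tu uT us.
  have [E1|E1] := leP (`|g t - g s|) (eps j); first by left.
  have [E2|E2] := leP (`|g u - g t|) (eps j); first by right.
  exfalso.
  have sT : 0 <= s <= T by apply/andP; split; clear_lra.
  have tT : 0 <= t <= T by apply/andP; split; clear_lra.
  have uT' : 0 <= u <= T by apply/andP; split; clear_lra.
  pose e := Num.min ((`|g t - g s| - eps j) / 3) ((`|g u - g t| - eps j) / 3).
  have e0 : 0 < e by rewrite /e lt_min; apply/andP; split; clear_lra.
  have [e1 e2] : e <= (`|g t - g s| - eps j) / 3 /\ e <= (`|g u - g t| - eps j) / 3.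
    by rewrite /e !ge_min !lexx orbT.
  have Ee1 : eps j + 2 * e < `|g t - g s| by clear_lra.
  have Ee2 : eps j + 2 * e < `|g u - g t| by clear_lra.
  move: e1 e2 => _ _.
  have [f [[_ _ /(_ j)[_ _ f3]] [/= cs [ct cu]]]] := filter_ex (filterI GK
    (filterI (gP _ sT _ e0) (filterI (gP _ tT _ e0) (gP _ uT' _ e0)))).
  case: (f3 s t u s0 st tu uT us); first exact: far_perturbation Ee1.
  exact: far_perturbation Ee2.
Qed.

(** Steps at [t + 1 / n] converge pointwise to a path with the wrong value at [t], so right limits
    replace the values of [g] before [T]. The approximating times are strictly later than [t]
    because [g t] itself may be far from [f0 t]. *)
Lemma limit_regularization : 0 < T -> (forall e, 0 < e -> exists j, eps j < e) ->
  (forall j, 0 < del j) -> UltraFilter G -> G K ->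
  (forall t, 0 <= t <= T -> forall e, 0 < e -> G [set f | `|f t - g t| <= e]) ->
  exists2 f0, K f0 &
  [/\ f0 0 = g 0, f0 T = g T &
  forall t, 0 <= t <= T -> forall e, 0 < e -> forall B, t < B ->
    exists t', [/\ t <= t' < B, t' <= T, t < T -> t < t' & `|g t' - f0 t| <= e]].
Proof.
move=> T0 eps0 del0 GU GK gP.
have limit_modulus := limit_modulus T0 GU GK gP.
have limit_bound := limit_bound GU GK gP.
have /choice[r rP] : forall t, exists p, 0 <= t < T -> forall e, 0 < e ->
    exists2 h, 0 < h & forall x, t < x < t + h -> `|g x - p| <= e.
  move=> t; case: (boolP (0 <= t < T)) => [tT|_]; last by exists 0.
  have [|p pP] := @cauchy_right_limit g t; last by exists p.
  move=> e e0; have [|j je] := eps0 (e / 2); first clear_lra.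
  have [_ _ g3] := limit_modulus j.
  have [h /andP[h0 _] H] := three_point_osc_right g3 (del0 j) tT.
  by exists h => // x y xh yh; apply: le_trans (H _ _ xh yh) _; clear_lra.
pose f0 t := if t < T then r t else g T.
have f0P t : 0 <= t <= T -> forall e, 0 < e -> forall B, t < B ->
    exists t', [/\ t <= t' < B, t' <= T, t < T -> t < t' & `|g t' - f0 t| <= e].
  move=> /andP[t0 tT] e e0 B tB; rewrite /f0; case: ifPn => [tT'|]; last first.
    rewrite -leNgt => Tt; exists T; split => //; first by apply/andP; split; clear_lra.
    by rewrite subrr normr0 ltW.
  have [|h h0 H] := rP t _ e e0; first by rewrite t0.
  pose m := Num.min (Num.min B T) (t + h).
  have tm : t < m by rewrite /m !lt_min; apply/andP; split; [apply/andP; split|]; clear_lra.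
  have [mB mT mh] : [/\ m <= B, m <= T & m <= t + h].
    by rewrite /m !ge_min !lexx !orbT.
  exists ((t + m) / 2); split; first by apply/andP; split; clear_lra.
  - clear_lra.
  - clear_lra.
  - by apply: H; apply/andP; split; clear_lra.
have f0T : f0 T = g T by rewrite /f0 ltxx.
(* The endpoint condition forces the right limit of [g] at 0 to be [g 0]. *)
have f00 : f0 0 = g 0.
  apply/eqP; rewrite -subr_eq0 -normr_le0; apply/ler_addgt0Pr => e e0; rewrite add0r.
  have [|j je] := eps0 (e / 2); first clear_lra.
  have e2 : 0 < e / 2 by clear_lra.
  have T0T : 0 <= (0 : R) <= T by rewrite lexx ltW.
  have [t' [/andP[t1 t2] t3 _ ?]] := f0P 0 T0T (e / 2) e2 _ (del0 j).
  have [+ _ _] := limit_modulus j => /(_ t' _ t2).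
  by rewrite t1 t3 => /(_ isT) ?; norm_lra.
exists f0 => //; split.
- move=> t /andP[t0 tT] e e0.
  have tT' : 0 <= t < T by rewrite t0.
  have [|h h0 H] := rP t tT' (e / 2); first clear_lra.
  pose m := Num.min h (T - t).
  have m0 : 0 < m by rewrite lt_min; apply/andP; split; clear_lra.
  have [mh mT] : m <= h /\ m <= T - t by rewrite /m !ge_min !lexx orbT.
  exists m => // x /andP[tx xm].
  have [||| x' [/andP[? ?] ? _ ?]] := f0P x _ (e / 2) _ (t + m); try clear_lra.
  have := H x' ltac:(apply/andP; split; clear_lra).
  have -> : r t = f0 t by rewrite /f0 tT.
  by move=> ?; norm_lra.
- move=> t /andP[t0 tT]; apply/ler_addgt0Pr => e e0.
  have [||t' [/andP[? ?] ? _ ?]] := f0P t _ e e0 (t + 1); try clear_lra.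
  have := limit_bound t' ltac:(apply/andP; split; clear_lra) => ?.
  by norm_lra.
- move=> j; apply: (@modulus_on_approx _ _ setT g) => //.
    move=> t tT e e0 B tB; have [t' [tt' t'T _ ?]] := f0P t tT e e0 B tB.
    by exists t'.
  exact/modulus_le_on/limit_modulus.
Qed.

(** Closeness at finitely many times is enough: on each short piece between them the three-point
    condition allows [f] one essential switch, which a time change moves to the jump of [f0]. *)
Lemma limit_J1 : 0 < T -> (forall e, 0 < e -> exists j, eps j < e) ->
  (forall j, 0 < del j) -> UltraFilter G -> G K ->
  (forall t, 0 <= t <= T -> forall e, 0 < e -> G [set f | `|f t - g t| <= e]) ->
  forall f0, K f0 -> f0 0 = g 0 -> f0 T = g T ->
  (forall t, 0 <= t <= T -> forall e, 0 < e -> forall B, t < B ->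
    exists t', [/\ t <= t' < B, t' <= T, t < T -> t < t' & `|g t' - f0 t| <= e]) ->
  forall r, 0 < r -> G [set f | J1dist T f0 f < r].
Proof.
move=> T0 eps0 del0 GU GK gP f0 Kf0 f00 f0T f0P r r0.
have limit_modulus := limit_modulus T0 GU GK gP.
(* Both the error [10 * e] of [matched_switch] and the time shift [h0] equal [r / 2]. *)
pose e := r / 20; have e0 : 0 < e by rewrite /e; clear_lra.
pose h0 := r / 2; have h00 : 0 < h0 by rewrite /h0; clear_lra.
(* This gives [g] one-sided oscillation at most [e / 2] and leaves [e / 4] for each of two right
   approximants. *)
have [|j je] := eps0 (e / 4); first clear_lra.
have dl0 := del0 j; set dl := del j in dl0.
have [gm0 gmT g3] := limit_modulus j; rewrite -/dl in gm0 gmT g3.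
have e40 : 0 < e / 4 by clear_lra.
(* The bound on [f0] includes the left end [p], where right approximants already lie inside the
   window; the comparison with [g] excludes it, since [g p] may differ from its right limit. *)
have window p q : 0 <= p -> q <= T ->
    (forall x y, p < x < q -> p < y < q -> `|g x - g y| <= e / 2) ->
    (forall x y, p <= x < q -> p <= y < q -> `|f0 x - f0 y| <= e) /\
    (forall x, p < x < q -> `|g x - f0 x| <= e).
  move=> p0 qT pq; split.
    move=> x y /andP[px xq] /andP[py yq].
    have [x' [/andP[? ?] _ xx' ?]] := f0P x ltac:(clear_lra) (e / 4) e40 q xq.
    have [y' [/andP[? ?] _ yy' ?]] := f0P y ltac:(clear_lra) (e / 4) e40 q yq.
    have x'x := xx' ltac:(clear_lra).
    have y'y := yy' ltac:(clear_lra).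
    have := pq x' y' ltac:(clear_lra) ltac:(clear_lra) => ?; norm_lra.
  move=> x /andP[px xq].
  have [x' [/andP[? ?] _ xx' ?]] := f0P x ltac:(clear_lra) (e / 4) e40 q xq.
  have x'x := xx' ltac:(clear_lra).
  have := pq x x' ltac:(clear_lra) ltac:(clear_lra) => ?; norm_lra.
have close x : 0 <= x <= T -> `|g x - f0 x| <= e -> G [set f | `|f x - f0 x| <= 2 * e].
  move=> xT ge; apply: filterS (gP _ xT _ e0) => f /= ?; norm_lra.
have switch a t b' b : 0 <= a -> a < t -> t < b' -> b' < b -> b <= T ->
    b - a < dl -> b - a <= h0 ->
    (forall x, a <= x < t -> `|f0 x - f0 a| <= e) ->
    (forall x, t <= x <= b -> `|f0 x - f0 b| <= e) ->
    `|g a - f0 a| <= e -> `|g b - f0 b| <= e -> `|g b' - f0 b'| <= e ->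
    G [set f | matched f0 f h0 (10 * e) a b].
  move=> a0 a_t tb' b'b bT bad bah f0a f0b /close ca /close cb /close cb'.
  move: ca cb cb' => /(_ ltac:(clear_lra)) ca /(_ ltac:(clear_lra)) cb /(_ ltac:(clear_lra)) cb'.
  apply: filterS (filterI GK (filterI ca (filterI cb cb'))).
  move=> f [[frc _ /(_ j)[_ _ f3]] [/= fa [fb fb']]].
  apply: (@matched_switch R T f0 f h0 e dl a t b' b) => //.
  move=> s t' u s0 st tu uT us.
  by case: (f3 s t' u s0 st tu uT us) => ?; [left|right]; clear_lra.
suff GT : G [set f | matched f0 f h0 (10 * e) 0 T].
  apply: filterS GT => f /= [lam [l0 lT lc li lm]].
  apply: (@le_lt_trans _ _ h0); last by rewrite /h0; clear_lra.
  apply: (@J1dist_le R T f0 f lam); try exact: ltW.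
  - by split.
  - by move=> t tT; have [] := lm t tT.
  - by move=> t tT; have [_ /le_trans] := lm t tT; apply; rewrite /e /h0; clear_lra.
have f0m : modulus_le T f0 (e / 4) dl.
  have [_ _ /(_ j)[f01 f02 f03]] := Kf0; split.
  - by move=> t tT td; apply: le_trans (f01 t tT td) (ltW je).
  - by move=> t tT td; apply: le_trans (f02 t tT td) (ltW je).
  - by move=> s t u s0 st tu uT us; case: (f03 s t u s0 st tu uT us) => ?;
      [left|right]; exact: le_trans (ltW je).
have {je gm0 gmT} gm : modulus_le T g (e / 4) dl.
  split.
  - by move=> t tT td; apply: le_trans (gm0 t tT td) (ltW je).
  - by move=> t tT td; apply: le_trans (gmT t tT td) (ltW je).
  - by move=> s t u s0 st tu uT us; case: (g3 s t u s0 st tu uT us) => ?;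
      [left|right]; exact: le_trans (ltW je).
have [gm0 gmT g3'] := gm; have [f0m0 f0mT _] := f0m.
clearbody e h0 dl; clear close limit_modulus gP Kf0 f0P GK r0 f0m gm g3.
(* Pieces are cut only where [g] and [f0] are close, which avoids the times at which the
   regularisation changed [g] noticeably. *)
apply: (@interval_chain (fun b => `|g b - f0 b| <= e)
  (fun a b => G [set f | matched f0 f h0 (10 * e) a b])) => //.
- move=> a b c ab bc Ga Gb; apply: filterS (filterI Ga Gb) => f [].
  exact: matched_trans.
- pose m := Num.min (Num.min T dl) h0.
  have m0 : 0 < m by rewrite !lt_min T0 dl0.
  have [mT md mh] : [/\ m <= T, m <= dl & m <= h0].
    by rewrite /m !ge_min !lexx !orbT.
  clearbody m.
  have near0 x : 0 <= x < m -> `|f0 x - f0 0| <= e / 4 /\ `|g x - g 0| <= e / 4.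
    move=> /andP[x0 xm]; have xT : 0 <= x <= T by rewrite x0 ltW ?(lt_le_trans xm).
    by have xd := lt_le_trans xm md; split; [exact: f0m0|exact: gm0].
  have good x : 0 <= x < m -> `|g x - f0 x| <= e.
    by move=> xd; have [? ?] := near0 x xd; rewrite f00 in near0 *; norm_lra.
  have osc x y : 0 <= x < m -> 0 <= y < m -> `|f0 x - f0 y| <= e.
    move=> xd yd; have [? _] := near0 x xd; have [? _] := near0 y yd.
    norm_lra.
  exists (m / 2); split; [clear_lra|by apply: good; clear_lra|].
  (* [f0] oscillates by at most [e] on this piece, so the switch point is arbitrary. *)
  apply: (switch 0 (m / 8) (m / 4)); try clear_lra.
  + by move=> x /andP[? ?]; apply: osc; clear_lra.
  + by move=> x /andP[? ?]; apply: osc; clear_lra.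
  + by apply: good; clear_lra.
  + by apply: good; clear_lra.
  + by apply: good; clear_lra.
- move=> ts ts0 tsT; clear gm0 gmT f0m0 f0mT f00 f0T.
  have tsI : 0 < ts <= T by rewrite ts0 ltW.
  have tsI' : 0 <= ts < T by rewrite tsT ltW.
  have [hl /andP[hl0 hlt] Hl] := three_point_osc_left g3' dl0 tsI.
  have [|oscl goodl] := window (ts - hl) ts ltac:(by rewrite subr_ge0) (ltW tsT).
    by move=> x y xh yh; apply: le_trans (Hl _ _ xh yh) _; clear_lra.
  have [hr /andP[hr0 hrt] Hr] := three_point_osc_right g3' dl0 tsI'.
  have [||oscr goodr] := window ts (ts + hr) (ltW ts0).
    by rewrite addrC -lerBrDr.
    by move=> x y xh yh; apply: le_trans (Hr _ _ xh yh) _; clear_lra.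
  pose m := Num.min (Num.min hl hr) (Num.min dl h0).
  have m0 : 0 < m by rewrite !lt_min hl0 hr0 dl0.
  have [ml mr md mh] : [/\ m <= hl, m <= hr, m <= dl & m <= h0].
    by rewrite /m !ge_min !lexx !orbT.
  clearbody m; clear tsI tsI' hlt dl0 h00 e40 hl0 hr0 T0 window g3' Hl Hr.
  exists (m / 4); first clear_lra.
  move=> a la aT a0 ga; exists (ts + m / 4); split; try clear_lra.
    by apply: goodr; clear_lra.
  (* A possible jump of [f0] at [ts] is straddled by a piece with switch point [ts]. A piece that
     starts at [ts] sees only small oscillation, and its switch point is arbitrary. *)
  move: aT; rewrite le_eqVlt => /orP[/eqP ats|ats].
  + rewrite ats in ga a0 *.
    apply: (switch ts (ts + m / 16) (ts + m / 8)); try clear_lra.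
    * by move=> x /andP[? ?]; apply: oscr; clear_lra.
    * by move=> x /andP[? ?]; apply: oscr; clear_lra.
    * by apply: goodr; clear_lra.
    * by apply: goodr; clear_lra.
  + apply: (switch a ts (ts + m / 8)); try clear_lra.
    * by move=> x /andP[? ?]; apply: oscl; clear_lra.
    * by move=> x /andP[? ?]; apply: oscr; clear_lra.
    * by apply: goodr; clear_lra.
    * by apply: goodr; clear_lra.
- have TI : 0 < T <= T by rewrite T0 lexx.
  have [hl /andP[hl0 hlt] Hl] := three_point_osc_left g3' dl0 TI.
  have [|oscl goodl] := window (T - hl) T ltac:(by rewrite subr_ge0) (lexx T).
    by move=> x y xh yh; apply: le_trans (Hl _ _ xh yh) _; clear_lra.
  pose m := Num.min hl (Num.min dl h0).
  have m0 : 0 < m by rewrite !lt_min hl0 dl0.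
  have [ml md mh] : [/\ m <= hl, m <= dl & m <= h0].
    by rewrite /m !ge_min !lexx !orbT.
  clearbody m; exists (m / 2); first clear_lra.
  move=> a la aT a0 ga; clear TI hl0 h00 dl0 T0.
  have f0TT : `|g T - f0 T| <= e by rewrite f0T subrr normr0 ltW.
  apply: (switch a (a + (T - a) / 3) (a + (T - a) / 2)); try clear_lra.
  + by move=> x /andP[? ?]; apply: oscl; clear_lra.
  + move=> x /andP[? ?]; rewrite distrC; apply: (@le_trans _ _ (e / 4)); last clear_lra.
    by apply: f0mT; clear_lra.
  + by apply: goodl; clear_lra.
Qed.

End Limit.

(** Without a finite subcover, the sets [K] minus finite unions generate a proper filter. An
    ultrafilter above it converges in J1 distance to some [f0] of [K], yet avoids the open set [O i]
    that contains [f0]. *)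
Lemma modulus_set_compact : 0 < T -> (forall e, 0 < e -> exists j, eps j < e) ->
  (forall j, 0 < del j) -> J1compact T K.
Proof.
move=> T0 eps0 del0; split; first exact: modulus_set_cadlag.
move=> I O Oopen KO; apply: contrapT => nofin.
pose U (s : seq I) := \big[setU/set0]_(i <- s) O i.
have Ucov (s : seq I) : ~ (K `<=` U s).
  move=> KU; apply: nofin; exists (size s), (tnth (in_tuple s)).
  move=> f /KU; rewrite /U big_tnth.
  elim/big_ind: _ => [//|A B fA fB [/fA//|/fB//]|i _ Oif].
  by exists i.
pose F : set_system (R -> R) := [set A | exists s : seq I, K `\` U s `<=` A].
have FF : ProperFilter F.
  apply: Build_ProperFilter_ex.
    move=> A [s sA]; apply: contrapT => nA; apply: (Ucov s) => f Kf.
    by apply: contrapT => nUf; apply: nA; exists f; apply: sA.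
  split.
  - by exists [::].
  - move=> A B [s sA] [s' sB]; exists (s ++ s') => f [Kf].
    rewrite /U big_cat/= => nU; split; [apply: sA|apply: sB]; split => // Uf; apply: nU.
      by left.
    by right.
  - by move=> A B AB [s sA]; exists s => f /sA/AB.
have [G [GU FG]] := ultraFilterLemma FF.
have GK : G K by apply: FG; exists [::] => f [].
have /choice[g gP] : forall t, exists p, 0 <= t <= T -> forall e, 0 < e ->
    G [set f | `|f t - p| <= e].
  move=> t; case: (boolP (0 <= t <= T)) => [tT|_]; last by exists 0.
  have [|p pP] := @ultra_pointwise_limit G t M GU; last by exists p.
  by apply: filterS GK => f [_ + _]; apply.
have [f0 Kf0 [f00 f0T f0P]] := limit_regularization T0 eps0 del0 GU GK gP.
have [i _ Oi] := KO f0 Kf0.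
have [_ /(_ _ Oi)[r r0 ball_r]] := Oopen i.
have GJ := limit_J1 T0 eps0 del0 GU GK gP Kf0 f00 f0T f0P r0.
have GC : G (K `\` O i) by apply: FG; exists [:: i]; rewrite /U big_seq1.
have [f [[Kf nOf] fr]] := filter_ex (filterI GC GJ).
by apply: nOf; apply: ball_r => //; exact: modulus_set_cadlag.
Qed.

End SkorohodCompactness.

(** * Jump paths *)

Section RingCount.
Variable R : realType.
Implicit Types (J S : nat -> R) (t : R).

(** The time search of [state_at], isolated so that a path becomes the discrete chain read at this
    index. *)
Definition ring_count J t : nat :=
  match pselect (exists k, t < J k.+1) with
  | left h => ex_minn (P := fun k => t < J k.+1) h
  | right _ => 0
  end.

(* The second case is the junk value 0 of state_at after an explosion of the
   clock, a null event on which measurability still has to be checked. *)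
Variant ring_count_spec J t : nat -> Prop :=
| RingCount k of t < J k.+1 & (forall i, (i < k)%N -> J i.+1 <= t) :
    ring_count_spec J t k
| RingCountExploded of (forall i, J i.+1 <= t) : ring_count_spec J t 0.

Lemma ring_countP J t : ring_count_spec J t (ring_count J t).
Proof.
rewrite /ring_count; case: pselect => [h|h].
  case: ex_minnP => k kJ kmin; apply: RingCount => // i ik.
  by rewrite leNgt; apply/negP => /kmin; rewrite leqNgt ik.
apply: RingCountExploded => i; rewrite leNgt; apply/negP => iJ.
by apply: h; exists i.
Qed.

Lemma ring_count_eq J t k : ring_count J t = k <->
  (t < J k.+1 /\ forall i, (i < k)%N -> J i.+1 <= t) \/
  (k = 0%N /\ forall i, J i.+1 <= t).
Proof.
case: ring_countP => [m tm mmin|H]; split.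
- by move=> <-; left.
- case=> [[tk kmin]|[_ /(_ m)]]; last by rewrite leNgt tm.
  have [mk|km|//] := ltngtP m k.
    by have := kmin _ mk; rewrite leNgt tm.
  by have := mmin _ km; rewrite leNgt tk.
- by move=> <-; right.
- by case=> [[+ _]|[->//]]; rewrite ltNge H.
Qed.

(** After an explosion all later times share the index 0, so paths are right continuous for every
    outcome and not just almost surely. *)
Lemma ring_count_right_constant J t : exists2 h, 0 < h &
  forall x, t <= x < t + h -> ring_count J x = ring_count J t.
Proof.
case: (ring_countP J t) => [k tk kmin|H].
  exists (J k.+1 - t); first by rewrite subr_gt0.
  move=> x /andP[tx xk]; apply/ring_count_eq; left; split; first by lra.
  by move=> i /kmin /le_trans; apply.
exists 1 => // x /andP[tx _]; apply/ring_count_eq; right; split => // i.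
exact: le_trans (H i) tx.
Qed.

Lemma jumps_monotone J : (forall k, J k <= J k.+1) ->
  forall i j, (i <= j)%N -> J i <= J j.
Proof.
move=> Jnd i j; apply: (homo_leq (r := fun x y => x <= y)) => // ? ? ?.
exact: le_trans.
Qed.

Lemma ring_count_bounds J T M : J 0%N = 0 -> (forall k, J k <= J k.+1) -> T < J M ->
  forall t, 0 <= t <= T ->
  [/\ J (ring_count J t) <= t, t < J (ring_count J t).+1 & (ring_count J t < M)%N].
Proof.
move=> J0 Jnd JM t /andP[t0 tT]; case: ring_countP => [k tk kmin|H]; last first.
  by have := lt_le_trans JM (le_trans (Jnd M) (le_trans (H M) tT)); rewrite ltxx.
have Jk : J k <= t by case: k kmin {tk} => [|k] kmin; [rewrite J0|exact: kmin].
split => //; rewrite ltnNge; apply/negP => /(jumps_monotone Jnd) ?; lra.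
Qed.

Lemma ring_count_nd J T M : J 0%N = 0 -> (forall k, J k <= J k.+1) -> T < J M ->
  forall s t, 0 <= s -> s <= t -> t <= T -> (ring_count J s <= ring_count J t)%N.
Proof.
move=> J0 Jnd JM s t s0 st tT.
have [s1 _ _] := @ring_count_bounds J T M J0 Jnd JM s ltac:(lra).
have [_ t2 _] := @ring_count_bounds J T M J0 Jnd JM t ltac:(lra).
by rewrite leqNgt; apply/negP => /(jumps_monotone Jnd) ?; lra.
Qed.

(** An increment above [eps] takes at least [L] rings. Two in a row take [2 * L >= L + 1], hence [L]
    complete waiting times inside the window. Time 0 counts as a ring, so [L] rings suffice there.
    Near [T] the waiting time straddling [t] is incomplete: either one more ring is guaranteed, or
    no ring may fall just before [T]. *)
Lemma jump_path_modulus J S (T : R) (M : nat) (b eps dl : R) (L : nat) :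
  J 0%N = 0 -> (forall k, J k <= J k.+1) -> T < J M ->
  (forall i j, (i <= j)%N -> `|S j - S i| <= b * (j - i)%:R) ->
  (0 < L)%N ->
  (forall r, eps < b * r%:R -> (L <= r)%N) ->
  (forall i, (i <= M)%N -> dl <= J (i + L)%N - J i) ->
  (forall r, eps < b * r%:R -> (L < r)%N) \/
    (forall i, (0 < i <= M)%N -> ~ (T - dl < J i <= T)) ->
  0 < T -> modulus_le T (fun t => S (ring_count J t)) eps dl.
Proof.
move=> J0 Jnd JM Slip L0 Llarge gaps end_gap T0.
have bounds := ring_count_bounds J0 Jnd JM.
have Jmon := jumps_monotone Jnd.
have far (s t : R) : 0 <= s -> s <= t -> t <= T ->
    eps < `|S (ring_count J t) - S (ring_count J s)| ->
    eps < b * (ring_count J t - ring_count J s)%:R.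
  move=> s0 st tT /lt_le_trans; apply.
  by apply: Slip; exact: ring_count_nd JM _ _ _ _ _.
split.
- move=> t /andP[t0 tT] td; rewrite leNgt; apply/negP.
  move=> /(far 0 t (lexx 0) t0 tT)/(Llarge _) Lr.
  have [t1 _ _] := bounds t ltac:(lra).
  have [_ _ u3] := bounds 0 ltac:(lra).
  have := gaps _ (ltnW u3).
  have : J (ring_count J 0 + L)%N <= J (ring_count J t) by apply: Jmon; lia.
  by have := Jmon _ _ (leq0n (ring_count J 0)); rewrite J0 => ? ? ?; lra.
- move=> t /andP[t0 tT] td; rewrite leNgt; apply/negP.
  move=> /(far t T t0 tT (lexx T)) H; have Lr := Llarge _ H.
  have [_ t2 t3] := bounds t ltac:(lra).
  have [u1 _ u3] := bounds T ltac:(lra).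
  case: end_gap => [/(_ _ H) Lr'|/(_ (ring_count J T))].
    have := gaps _ t3.
    have : J ((ring_count J t).+1 + L)%N <= J (ring_count J T).
      by apply: Jmon; lia.
    by move=> ? ?; lra.
  move=> /(_ ltac:(lia)); apply.
  have : J (ring_count J t).+1 <= J (ring_count J T) by apply: Jmon; lia.
  by move=> ?; lra.
- move=> s t u s0 st tu uT us.
  have [?|E1] := leP `|S (ring_count J t) - S (ring_count J s)| eps; first by left.
  have [?|E2] := leP `|S (ring_count J u) - S (ring_count J t)| eps; first by right.
  exfalso.
  move: E1 => /(far s t s0 (ltW st) ltac:(lra))/(Llarge _) Lr1.
  move: E2 => /(far t u ltac:(lra) (ltW tu) uT)/(Llarge _) Lr2.
  have [_ s2 s3] := bounds s ltac:(lra).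
  have [u1 _ _] := bounds u ltac:(lra).
  have := gaps _ s3.
  have : J ((ring_count J s).+1 + L)%N <= J (ring_count J u).
    by apply: Jmon; lia.
  by move=> ? ?; lra.
Qed.

End RingCount.

(** * The collision process *)

Section Observable.
Variables (R : realType) (N d : nat).

Definition edge_midpoint (x : site N d) (l : 'I_d) (s : bool) : 'rV[R]_d :=
  pos R x + (if s then 1 else -1) * ((N%:R)^-1 / 2) *: unitv R l.

Definition collision_weight (n : R) : R := (N%:R)^-1 ^+ 2 / ((N%:R)^-1 ^+ d * n ^+ 2).

Definition collision_observable (n : R) (phi : 'I_d -> bool -> 'rV[R]_d -> R)
    (st : state N d) : R :=
  \sum_(l < d) \sum_(s : bool) \sum_(x : site N d)
    collision_weight n * (st_C st (x, lattice_shift x l s))%:R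
    * phi l s (edge_midpoint x l s).

Lemma st_C_step (st : state N d) p q :
  st_C (step st p) q = (st_C st q + [&& st_eta st p.1, st_eta st p.2 & q == p])%N.
Proof.
case: p => x y /=; case: (st_eta st x) => /=; last by rewrite addn0.
case: (st_eta st y) => /=; last by rewrite addn0.
by case: (q == (x, y)); rewrite ?addn0 ?addn1.
Qed.

(** Only the count at [p] can change, hence for each direction and sign only the summand [x = p.1].
    All [2 * d] of them can move at once when [N = 1], where the shifts coincide. *)
Lemma collision_observable_step n phi (F : R) st p : 0 <= F ->
  (forall l s x, `|phi l s (edge_midpoint x l s)| <= F) ->
  `|collision_observable n phi (step st p) - collision_observable n phi st|
    <= 2 * d%:R * F * collision_weight n.
Proof.
move=> F0 phiF.
have k0 : 0 <= collision_weight n.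
  rewrite /collision_weight; apply: divr_ge0; first exact: sqr_ge0.
  by rewrite mulr_ge0 ?sqr_ge0// exprn_ge0// invr_ge0.
have -> : 2 * d%:R * F * collision_weight n =
    \sum_(l < d) \sum_(s : bool) \sum_(x : site N d)
      collision_weight n * (x == p.1)%:R * F.
  under eq_bigr do under eq_bigr do rewrite -mulr_suml -mulr_sumr.
  have -> : \sum_(x : site N d) (x == p.1)%:R = 1 :> R.
    rewrite (bigD1 p.1)//= eqxx big1 ?addr0// => x /negbTE ->; by [].
  by rewrite !sumr_const card_ord card_bool mulr1; ring.
rewrite /collision_observable -sumrB; apply: le_trans (ler_norm_sum _ _ _) _.
apply: ler_sum => l _; rewrite -sumrB; apply: le_trans (ler_norm_sum _ _ _) _.
apply: ler_sum => s _; rewrite -sumrB; apply: le_trans (ler_norm_sum _ _ _) _.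
apply: ler_sum => x _; rewrite st_C_step -mulrBl -mulrBr natrD addrAC subrr add0r.
rewrite normrM normrM (ger0_norm k0) ger0_norm//.
apply: ler_pM => //; first by rewrite mulr_ge0.
apply: ler_wpM2l => //; rewrite ler_nat; do 2 case: (st_eta _ _) => //=.
by case: eqP => // <-; rewrite eqxx.
Qed.

End Observable.

(** The midpoints of all lattices lie in the fixed compact box [[-1, 2]^d], so the bound is uniform
    in [N]. *)
Lemma edge_midpoint_bounded (R : realType) d (f : 'rV[R]_d -> R) : continuous f ->
  exists2 F : R, 0 <= F & forall N (x : site N d) (l : 'I_d) s, (0 < N)%N ->
    `|f (edge_midpoint R x l s)| <= F.
Proof.
move=> fc.
pose B := [set v : 'rV[R]_d | forall i, `[-1, 2 : R]%classic (v ord0 i)].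
have cB : compact B.
  by apply: (@rV_compact R d (fun=> `[-1, 2]%classic)) => i; exact: segment_compact.
have cfB : compact (f @` B) by apply: continuous_compact cB; apply: continuous_subspaceT.
have [F0 [_ HF]] := compact_bounded cfB.
exists (`|F0| + 1); first by rewrite addr_ge0.
move=> N x l s N0; apply: (HF (`|F0| + 1)).
  by apply: le_lt_trans (ler_norm _) _; rewrite ltrDl.
exists (edge_midpoint R x l s) => // i; rewrite /edge_midpoint !mxE/= in_itv/=.
have N0' : 0 < N%:R :> R by rewrite ltr0n.
have N1 : 1 <= N%:R :> R by rewrite ler1n.
have NV1 : N%:R^-1 <= 1 :> R by rewrite invf_le1.
have NV0 : 0 <= N%:R^-1 :> R by rewrite invr_ge0 ltW.
have x0 : 0 <= (x i)%:R / N%:R :> R by rewrite divr_ge0.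
have x1 : (x i)%:R / N%:R <= 1 :> R.
  by rewrite ler_pdivrMr// mul1r ler_nat ltnW.
by case: s; case: (l == i); rewrite /= ?mulr1 ?mulr0; lra.
Qed.

Section ChainPath.
Variables (R : realType) (N d : nat) (Omega : Type).
Variables (eta0 : Omega -> site N d -> bool) (tau : nat -> Omega -> R)
          (U : nat -> Omega -> site N d * site N d).

Lemma state_atE w t :
  state_at eta0 tau U w t = chain eta0 U w (ring_count (jump_time tau w) t).
Proof. by rewrite /state_at /ring_count; case: pselect. Qed.

Lemma collision_pairingE n phi w t : collision_pairing eta0 tau U n phi w t =
  collision_observable n phi (chain eta0 U w (ring_count (jump_time tau w) t)).
Proof. by rewrite -state_atE. Qed.

Lemma collision_pairing_right_continuous T n phi w :
  right_continuous_lt T (collision_pairing eta0 tau U n phi w).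
Proof.
move=> t _ e e0; have [h h0 H] := ring_count_right_constant (jump_time tau w) t.
exists h => // x /andP[tx xh]; rewrite !collision_pairingE H ?subrr ?normr0 ?ltW//.
Qed.

Lemma chain_lipschitz n phi (F : R) w : 0 <= F ->
  (forall l s x, `|phi l s (@edge_midpoint R N d x l s)| <= F) ->
  forall i j, (i <= j)%N ->
  `|collision_observable n phi (chain eta0 U w j) -
    collision_observable n phi (chain eta0 U w i)|
  <= 2 * d%:R * F * collision_weight N d n * (j - i)%:R.
Proof.
move=> F0 phiF i j /subnK <-; rewrite addnK.
elim: (j - i)%N => [|k IH]; first by rewrite add0n subrr normr0 mulr0.
rewrite addSn (mulrSr 1 k) mulrDr mulr1 [leRHS]addrC /=.
apply: le_trans (ler_distD (collision_observable n phi (chain eta0 U w (k + i))) _ _) _.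
by apply: lerD => //; exact: collision_observable_step.
Qed.

Lemma jump_time0 w : jump_time tau w 0 = 0.
Proof. by rewrite /jump_time big_ord0. Qed.

Lemma jump_timeS w k : jump_time tau w k.+1 = jump_time tau w k + tau k w.
Proof. by rewrite /jump_time big_ord_recr. Qed.

Lemma jump_time_window w i L :
  jump_time tau w (i + L) - jump_time tau w i = \sum_(j < L) tau (i + j)%N w.
Proof.
elim: L => [|L IH]; first by rewrite addn0 subrr big_ord0.
by rewrite addnS jump_timeS big_ord_recr/= -IH addrAC.
Qed.

Lemma chain_ext w w' k : eta0 w = eta0 w' -> (forall i, (i < k)%N -> U i w = U i w') ->
  chain eta0 U w k = chain eta0 U w' k.
Proof.
move=> e0; elim: k => [|k IH] HU /=; first by rewrite /init_state e0.
by rewrite IH ?HU// => i ik; apply: HU; rewrite ltnS ltnW.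
Qed.

End ChainPath.

(** * Measurability of the paths and of the modulus event *)

Section Measurability.
Variables (R : realType) (N d : nat) (dO : measure_display) (Omega : measurableType dO).
Variables (eta0 : Omega -> site N d -> bool) (tau : nat -> Omega -> R)
          (U : nat -> Omega -> site N d * site N d).
Hypothesis gen_meas : forall i A, gen_events eta0 tau U i A -> measurable A.

Lemma measurable_finType_preimage (F : finType) (g : Omega -> F) (Q : set F) :
  (forall v, measurable [set w | g w = v]) -> measurable [set w | Q (g w)].
Proof.
move=> mg.
have -> : [set w | Q (g w)] = \bigcup_(v in Q) [set w | g w = v].
  by apply/seteqP; split => w /=; [move=> Qw; exists (g w)|move=> [v Qv /= ->]].
by apply: fin_bigcup_measurable => // v _; exact: mg.
Qed.

Lemma measurable_forall (I : countType) (A : I -> Omega -> Prop) :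
  (forall i, measurable [set w | A i w]) -> measurable [set w | forall i, A i w].
Proof.
move=> mA.
have -> : [set w | forall i, A i w] = ~` \bigcup_i ~` [set w | A i w].
  apply/seteqP; split => w /= H; first by move=> [i _]; apply; exact: H.
  by move=> i; apply: contrapT => nA; apply: H; exists i.
apply: measurableC; apply: countable_bigcupT_measurable => // i.
exact: measurableC.
Qed.

Lemma measurable_imply (b : Prop) (A : Omega -> Prop) :
  (b -> measurable [set w | A w]) -> measurable [set w | b -> A w].
Proof.
move=> mA; have [hb|hb] := pselect b.
  by rewrite (_ : [set w | _] = [set w | A w]); [exact: mA|
    apply/seteqP; split => w /=; [apply|move=> ? _]].
rewrite (_ : mkset _ = setT); first exact: measurableT.
by apply/seteqP; split => // w _ /hb.
Qed.

Lemma measurable_eta0 (Q : set {ffun site N d -> bool}) :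
  measurable [set w | Q [ffun x => eta0 w x]].
Proof.
apply: (measurable_finType_preimage (g := fun w => [ffun x => eta0 w x])) => v.
have -> : [set w | [ffun x => eta0 w x] = v] = [set w | forall x, eta0 w x = v x].
  apply/seteqP; split => w /=; first by move=> <- x; rewrite ffunE.
  by move=> H; apply/ffunP => x; rewrite ffunE.
apply: measurable_forall => x; apply: (gen_meas (i := inl (inl x))).
by exists [set v x].
Qed.

(** The state after [k] rings is a function of finitely many variables with finite ranges, so every
    property of it is measurable. *)
Lemma measurable_chain (Q : state N d -> Prop) k :
  measurable [set w | Q (chain eta0 U w k)].
Proof.
pose g w := ([ffun x => eta0 w x], [ffun i : 'I_k => U i w]).
pose Q' := [set v | exists2 w, g w = v & Q (chain eta0 U w k)].
have -> : [set w | Q (chain eta0 U w k)] = [set w | Q' (g w)].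
  apply/seteqP; split => w /=; first by exists w.
  move=> [w' [/ffunP e0 /ffunP eU]]; rewrite (chain_ext (w' := w))//.
    by apply/funext => x; have := e0 x; rewrite !ffunE.
  by move=> i ik; have := eU (Ordinal ik); rewrite !ffunE.
apply: measurable_finType_preimage => -[v1 v2].
have -> : [set w | g w = (v1, v2)] = [set w | [ffun x => eta0 w x] = v1] `&`
    [set w | forall i : 'I_k, U i w = v2 i].
  apply/seteqP; split => w /=; first by move=> [<- <-]; split => // i; rewrite ffunE.
  by move=> [<- H]; congr pair; apply/ffunP => i; rewrite ffunE.
apply: measurableI; first exact: (measurable_eta0 [set v1]).
apply: measurable_forall => i; apply: (gen_meas (i := inr (i : nat))).
by exists [set v2 i].
Qed.

Lemma measurable_tau j : measurable_fun setT (tau j).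
Proof. by move=> _ B mB; rewrite setTI; apply: (gen_meas (i := inl (inr j))); exists B. Qed.

Lemma measurable_jump_time k : measurable_fun setT (fun w => jump_time tau w k).
Proof.
elim: k => [|k IH].
  rewrite (_ : (fun _ => _) = cst 0); first exact: measurable_cst.
  by apply/funext => w; rewrite jump_time0.
rewrite (_ : (fun _ => _) = (fun w => jump_time tau w k) \+ tau k).
  by apply: measurable_realfun.measurable_funD => //; exact: measurable_tau.
by apply/funext => w; rewrite jump_timeS.
Qed.

Lemma measurable_ring_count t k :
  measurable [set w | ring_count (jump_time tau w) t = k].
Proof.
have mle i : measurable [set w | jump_time tau w i <= t].
  rewrite (_ : [set w | _] = (fun w => jump_time tau w i) @^-1` `]-oo, t]).
    by rewrite -[X in measurable X]setTI; exact: measurable_jump_time.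
  by apply/seteqP; split => w /=; rewrite in_itv.
have -> : [set w | ring_count (jump_time tau w) t = k] =
   (~` [set w | jump_time tau w k.+1 <= t] `&`
     [set w | forall i, (i < k)%N -> jump_time tau w i.+1 <= t]) `|`
   [set w | k = 0%N -> forall i, jump_time tau w i.+1 <= t] `&` [set w | k = 0%N].
  apply/seteqP; split => w /=.
    move=> /ring_count_eq[[tk kmin]|[k0 H]]; last by right.
    by left; split => //; apply/negP; rewrite -ltNge.
  move=> H; apply/ring_count_eq; case: H => [[/negP + H]|[H k0]].
    by rewrite -ltNge => ?; left.
  by right; split => //; exact: H.
apply: measurableU; apply: measurableI.
- exact/measurableC.
- by apply: measurable_forall => i; apply: measurable_imply.
- by apply: measurable_imply => _; apply: measurable_forall.
- have [k0|k0] := pselect (k = 0%N).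
    by rewrite (_ : mkset _ = setT); [exact: measurableT|apply/seteqP; split].
  by rewrite (_ : mkset _ = set0); [exact: measurable0|apply/seteqP; split].
Qed.

Lemma measurable_pairing n phi t :
  measurable_fun setT (fun w => collision_pairing eta0 tau U n phi w t).
Proof.
move=> _ B mB; rewrite setTI.
have -> : (fun w => collision_pairing eta0 tau U n phi w t) @^-1` B =
    \bigcup_k ([set w | ring_count (jump_time tau w) t = k] `&`
      [set w | B (collision_observable n phi (chain eta0 U w k))]).
  apply/seteqP; split => w /=; rewrite collision_pairingE.
    by move=> Bw; exists (ring_count (jump_time tau w) t).
  by move=> [k _ [/= <-]].
apply: bigcup_measurable => k _; apply: measurableI; first exact: measurable_ring_count.
exact: (measurable_chain (fun st => B (collision_observable n phi st))).
Qed.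

Lemma measurable_dist_le (f g : Omega -> R) (c : R) :
  measurable_fun setT f -> measurable_fun setT g ->
  measurable [set w | `|f w - g w| <= c].
Proof.
move=> mf mg.
have mfg : measurable_fun setT (fun w => `|f w - g w|).
  by apply: measurableT_comp => //; exact: measurable_realfun.measurable_funB.
rewrite (_ : [set w | _] = (fun w => `|f w - g w|) @^-1` `]-oo, c]).
  by rewrite -[X in measurable X]setTI; exact: mfg.
by apply/seteqP; split => w /=; rewrite in_itv.
Qed.

Lemma measurable_modulus_on (D : set R) (I : countType) (tm : I -> R) T n phi eps dl :
  range tm = D ->
  measurable [set w | modulus_on T D (collision_pairing eta0 tau U n phi w) eps dl].
Proof.
move=> DE; pose X w t := collision_pairing eta0 tau U n phi w t.
have mX t : measurable_fun setT (X ^~ t) by exact: measurable_pairing.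
have -> : [set w | modulus_on T D (X w) eps dl] =
  [set w | forall i, 0 <= tm i <= T -> tm i < dl -> `|X w (tm i) - X w 0| <= eps] `&`
  [set w | forall i, 0 <= tm i <= T -> T - dl < tm i -> `|X w T - X w (tm i)| <= eps] `&`
  [set w | forall i j k, [/\ 0 <= tm i, tm i < tm j, tm j < tm k, tm k <= T &
     tm k - tm i < dl] -> `|X w (tm j) - X w (tm i)| <= eps \/
     `|X w (tm k) - X w (tm j)| <= eps].
  rewrite -DE; apply/seteqP; split => w /=.
    move=> [H1 H2 H3]; split; first split.
    - by move=> i; apply: H1; exists i.
    - by move=> i; apply: H2; exists i.
    - by move=> i j k [? ? ? ? ?]; apply: H3 => //.
  move=> [[H1 H2] H3]; split.
  - by move=> _ [i _ <-]; exact: H1.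
  - by move=> _ [i _ <-]; exact: H2.
  - by move=> _ _ _ [i _ <-] [j _ <-] [k _ <-] *; apply: H3; split.
apply: measurableI; first apply: measurableI.
- apply: measurable_forall => i; do 2 apply: measurable_imply => _.
  exact: measurable_dist_le.
- apply: measurable_forall => i; do 2 apply: measurable_imply => _.
  exact: measurable_dist_le.
- do 3 apply: measurable_forall => ?; apply: measurable_imply => _.
  by apply: measurableU; exact: measurable_dist_le.
Qed.

Lemma measurable_modulus_set (T M n : R) phi (eps del : nat -> R) : 0 < T ->
  measurable [set w | modulus_set T M eps del (collision_pairing eta0 tau U n phi w)].
Proof.
move=> T0; pose X w t := collision_pairing eta0 tau U n phi w t.
(* The rationals determine a right-continuous path on [[0, T[]; the value at [T] has no approximants
   from the right within [[0, T]], so [T] is added. *)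
pose tm (o : option rat) : R := if o is Some q then ratr q else T.
have approx w t : 0 <= t <= T -> forall e, 0 < e -> forall B, t < B ->
    exists t', [/\ range tm t', t <= t' < B, t' <= T & `|X w t' - X w t| <= e].
  move=> /andP[t0 tT] e e0 B tB; move: tT; rewrite le_eqVlt => /orP[/eqP tE|tT].
    rewrite tE in tB *; exists T; split => //; first by exists None.
      by rewrite lexx.
    by rewrite subrr normr0 ltW.
  have tT' : 0 <= t < T by rewrite t0 tT.
  have [h h0 H] := @collision_pairing_right_continuous _ _ _ _ eta0 tau U T n phi w t tT' e e0.
  pose m := Num.min (Num.min B T) (t + h).
  have tm' : t < m by rewrite /m !lt_min tB tT ltrDl.
  have [mB mT mh] : [/\ m <= B, m <= T & m <= t + h].
    by rewrite /m !ge_min !lexx !orbT.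
  have [q] := rat_in_itvoo tm'; rewrite in_itv/= => /andP[tq qm].
  exists (ratr q); split.
  - by exists (Some q).
  - by rewrite (ltW tq) (lt_le_trans qm).
  - by rewrite ltW// (lt_le_trans qm).
  - by apply: H; rewrite tq (lt_le_trans qm).
have -> : [set w | modulus_set T M eps del (X w)] =
    [set w | forall o, 0 <= tm o <= T -> `|X w (tm o) - 0| <= M] `&`
    [set w | forall j, modulus_on T (range tm) (X w) (eps j) (del j)].
  apply/seteqP; split => w /=.
    move=> [_ H1 H2]; split; last by move=> j; exact/modulus_le_on.
    by move=> o oT; rewrite subr0; exact: H1.
  move=> [H1 H2]; split.
  - exact: collision_pairing_right_continuous.
  - move=> t tT; apply/ler_addgt0Pr => e e0.
    have tt1 : t < t + 1 by rewrite ltrDl.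
    have [t' [[q _ <-] /andP[to _] oT H]] := approx w t tT e e0 (t + 1) tt1.
    have /andP[t0 _] := tT.
    have := H1 q; rewrite (le_trans t0 to) oT subr0 => /(_ isT) H3.
    by rewrite -[X w t](subKr (X w (tm q))); apply: le_trans (ler_normB _ _) _; exact: lerD.
  - by move=> j; apply: (modulus_on_approx _ _ (approx w)).
apply: measurableI.
  apply: measurable_forall => o; apply: measurable_imply => _.
  by apply: measurable_dist_le => //; exact: measurable_pairing.
by apply: measurable_forall => j; apply: measurable_modulus_on.
Qed.

End Measurability.

(** * Probability estimates for the clocks *)

Lemma exponential_prob_le (R : realType) (rate : R) (A : set R) : 0 <= rate ->
  measurable A -> (exponential_prob rate A <= rate%:E * lebesgue_measure A)%E.
Proof.
move=> r0 mA; rewrite -integral_cst//; apply: ge0_le_integral => //.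
- by move=> x _; rewrite lee_fin exponential_pdf_ge0.
- apply/measurable_EFinP; apply: measurable_funTS.
  exact: measurable_exponential_pdf.
- move=> x _; rewrite /= lee_fin; have [x0|x0] := ltP x 0.
    by rewrite lt0_exponential_pdf.
  rewrite exponential_pdfE// ler_piMr// expR_le1 mulNr oppr_le0.
  exact: mulr_ge0.
Qed.

(** Waiting times are nonnegative only almost surely; this makes the exceptional event null. *)
Lemma exponential_prob_lt0 (R : realType) (rate : R) :
  exponential_prob rate `]-oo, 0[ = 0%E.
Proof.
rewrite /exponential_prob integral0_eq// => x /=; rewrite in_itv/= => x0.
by rewrite lt0_exponential_pdf.
Qed.

Lemma bigsetI_in (T : Type) (I : eqType) (s : seq I) (A : I -> set T) w :
  (forall i, i \in s -> A i w) -> (\big[setI/setT]_(i <- s) A i) w.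
Proof.
elim: s => [|i s IH] sA; first by rewrite big_nil.
rewrite big_cons; split; first by apply: sA; rewrite mem_head.
by apply: IH => j js; apply: sA; rewrite inE js orbT.
Qed.

Section RelativeBounds.
Variables (R : realType) (dO : measure_display) (Omega : measurableType dO).
Variables (P : probability Omega R) (E : set Omega).
Hypothesis mE : measurable E.

(* P (A | E) <= c, multiplied out so that it also makes sense when P E = 0. *)
Definition rel_le (A : set Omega) (c : R) : Prop :=
  measurable A /\ (P (E `&` A) <= (fine (P E) * c)%:E)%E.

Lemma fine_prob (A : set Omega) : measurable A -> (fine (P A))%:E = P A.
Proof. by move=> mA; rewrite fineK// fin_num_measure. Qed.

Lemma fine_prob_ge0 (A : set Omega) : 0 <= fine (P A).
Proof. by rewrite fine_ge0. Qed.

Lemma rel_le0 : rel_le set0 0.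
Proof. by split => //; rewrite setI0 measure0 mulr0. Qed.

Lemma rel_le_weak A c c' : c <= c' -> rel_le A c -> rel_le A c'.
Proof.
move=> cc' [mA PA]; split => //; apply: le_trans PA _.
by rewrite lee_fin ler_wpM2l// fine_prob_ge0.
Qed.

Lemma rel_leU A B a b : rel_le A a -> rel_le B b -> rel_le (A `|` B) (a + b).
Proof.
move=> [mA PA] [mB PB]; split; first exact: measurableU.
rewrite setIUr mulrDr EFinD; apply: le_trans (leeD PA PB).
by apply: measureU2; exact: measurableI.
Qed.

Lemma rel_le_bigU (I : Type) (r : seq I) (Q : pred I) (A : I -> set Omega) (c : I -> R) :
  (forall i, Q i -> rel_le (A i) (c i)) ->
  rel_le (\big[setU/set0]_(i <- r | Q i) A i) (\sum_(i <- r | Q i) c i).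
Proof.
move=> H; elim: r => [|i r IH]; first by rewrite !big_nil; exact: rel_le0.
by rewrite !big_cons; case: ifPn => // Qi; apply: rel_leU => //; exact: H.
Qed.

End RelativeBounds.

Section Clocks.
Variables (R : realType) (N d : nat) (dO : measure_display) (Omega : measurableType dO).
Variable (P : probability Omega R).
Variables (eta0 : Omega -> site N d -> bool) (tau : nat -> Omega -> R)
          (U : nat -> Omega -> site N d * site N d).
Hypothesis gen_meas : forall i A, gen_events eta0 tau U i A -> measurable A.
Hypothesis indep : mutually_independent P eta0 tau U.
Variable Q : set {ffun site N d -> bool}.
Let E : set Omega := [set w | Q [ffun x => eta0 w x]].

Lemma measurable_tau_preimage j B : measurable B -> measurable (tau j @^-1` B).
Proof. by move=> mB; apply: (gen_meas (i := inl (inr j))); exists B. Qed.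

Lemma measurable_tau_bigI (s : seq nat) (B : nat -> set R) :
  (forall j, measurable (B j)) ->
  measurable (\big[setI/setT]_(j <- s) tau j @^-1` B j).
Proof.
move=> mB; elim/big_ind: _ => [|? ? ? ?|j _]; [exact: measurableT|exact: measurableI|].
exact: measurable_tau_preimage.
Qed.

Lemma indep_config (e : {ffun site N d -> bool}) (s : seq nat) (B : nat -> set R) :
  uniq s -> (forall j, measurable (B j)) ->
  P ([set w | [ffun x => eta0 w x] = e] `&` \big[setI/setT]_(j <- s) tau j @^-1` B j) =
  (P [set w | [ffun x => eta0 w x] = e] * \prod_(j <- s) P (tau j @^-1` B j))%E.
Proof.
move=> us mB.
pose A (i : indices N d) : set Omega := match i with
  | inl (inl x) => (fun w => eta0 w x) @^-1` [set e x]
  | inl (inr j) => tau j @^-1` B j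
  | inr _ => setT end.
pose s1 : seq (indices N d) := [seq inl (inl x) | x <- enum (site N d)].
pose s2 : seq (indices N d) := [seq inl (inr j) | j <- s].
have E1 : [set w | [ffun x => eta0 w x] = e] = \big[setI/setT]_(i <- s1) A i.
  rewrite big_map; apply/seteqP; split => w /=.
    move=> <-; elim/big_ind: _ => // x _.
    by rewrite /A/= ffunE.
  move=> H; apply/ffunP => x; rewrite ffunE.
  have : x \in enum (site N d) by rewrite mem_enum.
  elim: (enum _) H => // y r IH; rewrite big_cons inE => -[Hy Hr] /orP[/eqP ->//|].
  exact: IH.
have E2 : \big[setI/setT]_(j <- s) tau j @^-1` B j = \big[setI/setT]_(i <- s2) A i.
  by rewrite big_map.
have gA i : i \in s1 ++ s2 -> gen_events eta0 tau U i (A i).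
  rewrite mem_cat => /orP[/mapP[x _ ->]|/mapP[j _ ->]]; first by exists [set e x].
  by exists (B j).
have u1 : uniq s1 by rewrite map_inj_uniq ?enum_uniq// => x y [].
have u2 : uniq s2 by rewrite map_inj_uniq// => x y [].
have u12 : uniq (s1 ++ s2).
  rewrite cat_uniq u1 u2 andbT/=; apply/hasPn => _ /mapP[j _ ->].
  by apply/negP => /mapP[].
have := indep u12 gA; rewrite !big_cat/= -E1 -E2 => ->.
rewrite [in RHS]E1 (indep (A := A))//; last first.
  by move=> i is1; apply: gA; rewrite mem_cat is1.
by congr (_ * _)%E; rewrite big_map.
Qed.

(** Independence is given for generating events only. [E] is a finite disjoint union of events
    fixing the initial configuration, each an intersection of generating events, and the product
    rule is additive over them. *)
Lemma indep_E (s : seq nat) (B : nat -> set R) :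
  uniq s -> (forall j, measurable (B j)) ->
  P (E `&` \big[setI/setT]_(j <- s) tau j @^-1` B j) =
  (fine (P E) * \prod_(j <- s) fine (P (tau j @^-1` B j)))%:E.
Proof.
move=> us mB.
have mE : measurable E by exact: (measurable_eta0 gen_meas Q).
set C := \big[setI/setT]_(j <- s) _.
have mC : measurable C by exact: measurable_tau_bigI.
have me e : measurable [set w | [ffun x => eta0 w x] = e].
  exact: (measurable_eta0 gen_meas [set e]).
have EE : E = \bigcup_(e in Q) [set w | [ffun x => eta0 w x] = e].
  by apply/seteqP; split => w /=; [move=> Qw; exists [ffun x => eta0 w x]|
    move=> [e Qe /= we]; rewrite /E/= we].
have tI : trivIset Q (fun e => [set w | [ffun x => eta0 w x] = e]).
  by move=> e e' _ _ [w [/= <- <-]].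
rewrite EFinM fine_prob// -prodEFin.
rewrite (eq_bigr (fun j => P (tau j @^-1` B j))); last first.
  by move=> j _; rewrite fine_prob//; exact: measurable_tau_preimage.
have fQ : finite_set Q by exact: finite_finset.
rewrite EE setI_bigcupl !measure_fin_bigcup//; last 2 first.
- by apply: trivIset_setIr.
- by move=> e _; exact: measurableI.
rewrite ge0_mule_fsuml//; apply: eq_fsbigr => e _.
exact: indep_config.
Qed.

(* L waiting times with sum at most L * h / 2 include at least L / 2 that are
   below h; this union over subsets needs only the independence of events. *)
Definition window_event (i L : nat) (h : R) : set Omega :=
  \big[setU/set0]_(S : {set 'I_L} | (L <= 2 * #|S|)%N)
    \big[setI/setT]_(j <- [seq (i + val j)%N | j <- enum S]) tau j @^-1` `[0, h[.

Lemma window_eventP i L h dl w : 0 < h -> 2 * dl <= L%:R * h ->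
  (forall j, 0 <= tau j w) -> \sum_(j < L) tau (i + j)%N w <= dl ->
  window_event i L h w.
Proof.
move=> h0 dlh t0 sumdl.
pose S := [set j : 'I_L | tau (i + j)%N w < h]%SET.
have LS : (L <= 2 * #|S|)%N.
  have cS : (#|S| + #|~: S| = L)%N by rewrite cardsC card_ord.
  suff : (2 * #|~: S| <= L)%N by lia.
  rewrite -(ler_nat R) natrM -(ler_pM2r h0); apply: le_trans dlh.
  rewrite -mulrA ler_wpM2l//; apply: le_trans sumdl.
  rewrite (bigID (mem (~: S)))/= -[leLHS]addr0; apply: lerD; last exact: sumr_ge0.
  rewrite mulr_natl -sumr_const; apply: ler_sum => j.
  by rewrite !inE -leNgt.
rewrite /window_event (bigD1 S)//=; left.
rewrite big_map; apply: bigsetI_in => j; rewrite mem_enum inE => tjh.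
by rewrite /= in_itv/= t0.
Qed.

Variable rate : R.
Hypothesis rate0 : 0 <= rate.
Hypothesis exp_law : forall j B, measurable B ->
  P (tau j @^-1` B) = exponential_prob rate B.

Lemma tau_itv_le j (a b : R) x y : a <= b ->
  fine (P (tau j @^-1` [set` Interval (BSide x a) (BSide y b)])) <= rate * (b - a).
Proof.
move=> ab; rewrite -lee_fin fine_prob; last exact: measurable_tau_preimage.
rewrite exp_law; last exact: measurable_itv.
apply: le_trans (exponential_prob_le rate0 (measurable_itv _)) _.
rewrite EFinM; apply: lee_pmul => //; rewrite ?lee_fin// lebesgue_measure_itv/=.
by case: ifPn => _; rewrite ?EFinD ?lee_fin ?subr_ge0.
Qed.

Lemma tau_neg_null j : P (tau j @^-1` `]-oo, 0[) = 0%E.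
Proof. by rewrite exp_law// exponential_prob_lt0. Qed.

(** At most [2 ^ L] subsets, each of probability at most [(p ^+ 2) ^+ #|S| <= p ^+ L]; the square in
    the hypothesis absorbs the half in [#|S| >= L / 2]. *)
Lemma window_event_le i L h p : 0 <= p <= 1 -> 0 <= h -> rate * h <= p ^+ 2 ->
  rel_le P E (window_event i L h) ((2 * p) ^+ L).
Proof.
move=> /andP[p0 p1] h0 hp.
apply: (@rel_le_weak _ _ _ _ _ _ (\sum_(S : {set 'I_L} | (L <= 2 * #|S|)%N) p ^+ L)).
  rewrite sumr_const exprMn -[leLHS]mulr_natl; apply: ler_wpM2r; first exact: exprn_ge0.
  rewrite -natrX ler_nat; apply: leq_trans (max_card _) _.
  by rewrite -cardsT -powersetT card_powerset cardsT card_ord.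
apply: rel_le_bigU => [|S LS]; first exact: (measurable_eta0 gen_meas Q).
split.
  by apply: measurable_tau_bigI => j; exact: measurable_itv.
rewrite indep_E//; last 1 first.
- by rewrite map_inj_uniq ?enum_uniq// => x y /addnI/val_inj.
rewrite lee_fin ler_wpM2l ?fine_prob_ge0// big_map.
apply: (@le_trans _ _ (\prod_(j <- enum S) p ^+ 2)).
  apply: ler_prod => j _; rewrite fine_prob_ge0/=.
  by apply: le_trans (tau_itv_le _ _ _ h0) _; rewrite subr0.
rewrite big_enum/= prodr_const -exprM.
by apply: ler_wiXn2l => //; rewrite p0.
Qed.

(* Discretising the first i waiting times with mesh dl confines the last one to
   an interval of length (i + 1) * dl that depends only on the discretisation. *)
Definition end_slot (i m : nat) (T dl : R) (k : {ffun 'I_i -> 'I_m}) (j : nat) : set R :=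
  if insub j is Some l then `[(k l)%:R * dl, (k l).+1%:R * dl[%classic
  else `]T - dl - (\sum_l k l + i)%:R * dl, T - (\sum_l k l)%:R * dl]%classic.

Definition end_event (i m : nat) (T dl : R) : set Omega :=
  \big[setU/set0]_(k : {ffun 'I_i -> 'I_m})
    \big[setI/setT]_(j <- index_iota 0 i.+1) tau j @^-1` end_slot T dl k j.

Lemma tau_slots_le1 l m (dl : R) : 0 < dl ->
  \sum_(v < m) fine (P (tau l @^-1` `[v%:R * dl, v.+1%:R * dl[)) <= 1.
Proof.
move=> dl0; rewrite -lee_fin -sumEFin.
pose F v := tau l @^-1` `[v%:R * dl, v.+1%:R * dl[.
have mF v : measurable (F v) by apply: measurable_tau_preimage; exact: measurable_itv.
rewrite (eq_bigr (fun v : 'I_m => P (F v))); last by move=> v _; exact: fine_prob (mF v).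
rewrite -(measure_bigsetU P (F := F))//.
  by apply: probability_le1; apply: bigsetU_measurable.
move=> v v' _ _ [w []]; rewrite /F/= !in_itv/= => /andP[v1 v2] /andP[v1' v2'].
apply/eqP; rewrite eqn_leq; apply/andP; split; rewrite -ltnS -(ltr_nat R) -(ltr_pM2r dl0).
  exact: le_lt_trans v1 v2'.
exact: le_lt_trans v1' v2.
Qed.

(** A discrete total probability formula: the bound on the last slot does not depend on [k], so the
    sum over [k] factorises into [i] slot sums, each at most 1. *)
Lemma end_event_le i m (T dl : R) : 0 < dl ->
  rel_le P E (end_event i m T dl) (rate * (i.+1%:R * dl)).
Proof.
move=> dl0.
pose c (k : {ffun 'I_i -> 'I_m}) :=
  (\prod_(l < i) fine (P (tau l @^-1` `[(k l)%:R * dl, (k l).+1%:R * dl[))) *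
  (rate * (i.+1%:R * dl)).
apply: (@rel_le_weak _ _ _ _ _ _ (\sum_k c k)).
  rewrite /c -mulr_suml -(bigA_distr_bigA (fun (l : 'I_i) (v : 'I_m) =>
    fine (P (tau l @^-1` `[v%:R * dl, v.+1%:R * dl[)))).
  apply: ler_piMl; first by do 2 apply: mulr_ge0 => //; exact: ltW.
  rewrite -/(\prod_(l < i) \sum_(v < m) fine (P (tau l @^-1` `[v%:R * dl, v.+1%:R * dl[))).
  apply: prodr_ile1 => l _.
  by rewrite tau_slots_le1// sumr_ge0// => v _; exact: fine_prob_ge0.
have mslot k j : measurable (@end_slot i m T dl k j).
  by rewrite /end_slot; case: insub => [l|]; exact: measurable_itv.
apply: rel_le_bigU => [|k _]; first exact: (measurable_eta0 gen_meas Q).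
split; first exact: measurable_tau_bigI.
rewrite indep_E ?iota_uniq// lee_fin ler_wpM2l ?fine_prob_ge0//.
rewrite big_nat_recr//= big_mkord /c; apply: ler_pM.
- by apply: prodr_ge0 => j _; exact: fine_prob_ge0.
- exact: fine_prob_ge0.
- by apply: ler_prod => l _; rewrite fine_prob_ge0 /end_slot valK/=.
- rewrite /end_slot insubN ?ltnn//.
  set K := (\sum_l k l)%N.
  apply: le_trans (tau_itv_le _ _ _ _) _.
    rewrite natrD mulrDl; have := mulr_ge0 (ler0n R i) (ltW dl0).
    by move: (K%:R * dl) (i%:R * dl) => x y y0; lra.
  by apply: ler_wpM2l => //; rewrite natrD (mulrSr 1 i); lra.
Qed.

Lemma end_eventP i m (T dl : R) w : 0 < dl -> T < m%:R * dl ->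
  (forall j, 0 <= tau j w) -> T - dl < jump_time tau w i.+1 <= T ->
  end_event i m T dl w.
Proof.
move=> dl0 Tm t0 /andP[TJ JT].
have J0 : 0 <= jump_time tau w i by apply: sumr_ge0.
(* Each of these waiting times is at most [T < m%:R * dl], so the [m] slots cover it. *)
have klt (l : 'I_i) : (Num.trunc (tau l w / dl) < m)%N.
  have td0 : 0 <= tau l w / dl by apply: divr_ge0 => //; exact: ltW.
  rewrite truncn_lt_nat// ltr_pdivrMr//; apply: le_lt_trans Tm.
  apply: le_trans JT; rewrite jump_timeS -[leLHS]addr0; apply: lerD => //.
  by rewrite /jump_time (bigD1 l)//= lerDl sumr_ge0.
pose k := [ffun l : 'I_i => Ordinal (klt l)].
have kP l : (k l)%:R * dl <= tau l w < (k l).+1%:R * dl.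
  rewrite -ler_pdivlMr// -ltr_pdivrMr// ffunE/=.
  by rewrite truncn_itv// divr_ge0// ltW.
rewrite /end_event (bigD1 k)//=; left; apply: bigsetI_in => j.
rewrite mem_index_iota /= ltnS leq_eqVlt => /orP[/eqP ->|ji]; last first.
  by rewrite /end_slot (insubT (fun j => (j < i)%N) ji) /= in_itv/=; exact: (kP (Ordinal ji)).
rewrite /end_slot insubN ?ltnn//= in_itv/=.
have K1 : (\sum_l k l)%:R * dl <= jump_time tau w i.
  rewrite natr_sum mulr_suml; apply: ler_sum => l _.
  by have /andP[] := kP l.
have K2 : jump_time tau w i <= (\sum_l k l + i)%:R * dl.
  rewrite natrD natr_sum mulrDl mulr_suml.
  have -> : i%:R * dl = \sum_(l < i) dl by rewrite sumr_const card_ord mulr_natl.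
  rewrite -big_split/=.
  apply: ler_sum => l _; have /andP[_ /ltW/le_trans] := kP l; apply.
  by rewrite (mulrSr 1 (k l)) mulrDl mul1r.
move: TJ JT; rewrite jump_timeS => TJ JT.
by apply/andP; split; lra.
Qed.

End Clocks.

(** * Exponential tightness *)

(** With [x] the oscillation in units of the jump size, every [r > x] is at least this length, and
    strictly larger if [x >= 1], as the condition at [T] wants. For [x < 1] the maximum keeps the
    length positive, strictness fails, and the end events take over. *)
Definition window_length (R : realType) (x : R) : nat := maxn 1 (Num.trunc x).

Lemma window_length_ge (R : realType) (x : R) : 0 <= x -> x / 2 <= (window_length x)%:R.
Proof.
move=> x0; rewrite /window_length; have [x1|x1] := ltP x 1.
  by apply: (@le_trans _ _ 1); [lra|rewrite ler1n leq_max].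
have t0 : (0 < Num.trunc x)%N by rewrite truncn_gt0.
rewrite (maxn_idPr t0); have := truncnS_gt x; rewrite (mulrSr 1).
have : 1 <= (Num.trunc x)%:R :> R by rewrite ler1n.
by move=> ? ?; lra.
Qed.

(** The order of quantifiers is the point: [p] and [dl] are fixed before the speed [s] and the
    number of rings [M]. *)
Lemma deviation_constants (R : realType) (a C c A0 e : R) (j : nat) :
  0 < a -> 0 < C -> 0 < c -> 0 <= A0 -> 0 < e ->
  exists p dl : R, [/\ 0 < p <= 1, 0 < dl & forall (s : R) (M : nat),
    0 < s -> M%:R <= A0 * s + 1 ->
    [/\ 2 * dl <= (window_length (e * s / c))%:R * (p ^+ 2 / (C * s)),
        M.+1%:R * (2 * p) ^+ window_length (e * s / c) <= expR (- (a * s)) / (2 ^ j.+3)%:R &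
        e * s / c < 1 -> M%:R * (C * s * (M%:R * dl)) <= expR (- (a * s)) / (2 ^ j.+3)%:R]].
Proof.
move=> a0 C0 c0 A00 e0.
pose k := e / c / 2; have k0 : 0 < k by rewrite /k !divr_gt0.
pose q := A0 / k + 2.
have q2 : 2 <= q by rewrite /q lerDr divr_ge0// ?ltW.
pose w : R := (2 ^ j.+3)%:R.
have w1 : 1 <= w by rewrite /w ler1n expn_gt0.
have E1 : 1 <= expR (a / k) by rewrite -(@expR0 R) ler_expR divr_ge0 ?ltW.
(* [Y ^+ L] with [2 * p = Y^-1] pays for everything: [2 ^ L >= L] and [q] for the windows, since
   [M.+1 <= q * L]; [w] for the level; and [expR (a / k) ^+ L >= expR (a * s)], since
   [L >= k * s]. *)
pose Y := 2 * q * w * expR (a / k).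
have Y2 : 2 <= Y.
  have qw : 2 <= q * w by nra.
  apply: (@le_trans _ _ (2 * q * w)); first by rewrite -mulrA; lra.
  by rewrite /Y ler_peMr// -mulrA; lra.
have Y0 : 0 < Y by lra.
pose p := (2 * Y)^-1.
have p0 : 0 < p by rewrite invr_gt0 mulr_gt0.
have p1 : p <= 1 by rewrite invf_le1 ?mulr_gt0//; lra.
(* If [e * s / c < 1], then [s <= c / e], and [D] bounds [M ^ 2 * C * s]. *)
pose D := (A0 * (c / e) + 1) ^+ 2 * (C * (c / e)).
have ce0 : 0 < c / e by rewrite divr_gt0.
have D0 : 0 < D.
  apply: mulr_gt0; last exact: mulr_gt0.
  by apply/exprn_gt0/ltr_pwDr => //; rewrite mulr_ge0// ltW.
(* The speed cancels in [k * s * (p ^+ 2 / (C * s))], so this choice suits every [s]. *)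
pose dl1 := k * p ^+ 2 / C / 2.
pose dl2 := expR (- (a * (c / e))) / w / D.
have w0 : 0 < w by lra.
exists p, (Num.min dl1 dl2); split; first by rewrite p0.
  rewrite lt_min; apply/andP; split.
    by rewrite /dl1; do 2 apply: divr_gt0 => //; apply: mulr_gt0 => //; exact: exprn_gt0.
  by rewrite /dl2; do 2 apply: divr_gt0 => //; exact: expR_gt0.
move=> s M s0 MA; set x := e * s / c; set L := window_length x.
have x0 : 0 < x by rewrite !divr_gt0// mulr_gt0.
have Lk : k * s <= L%:R.
  apply: le_trans (window_length_ge (ltW x0)).
  by rewrite le_eqVlt /x /k; apply/orP; left; apply/eqP; field; rewrite gt_eqF.
have L1 : (0 < L)%N by rewrite /L /window_length leq_max.
have sL : s <= L%:R / k by rewrite ler_pdivlMr// mulrC.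
split.
- apply: (@le_trans _ _ (2 * dl1)).
    by apply: ler_wpM2l => //; rewrite ge_min lexx.
  have -> : 2 * dl1 = k * s * (p ^+ 2 / (C * s)).
    by rewrite /dl1; field; rewrite !gt_eqF.
  by apply: ler_wpM2r => //; rewrite divr_ge0 ?exprn_ge0 ?mulr_ge0 ?ltW.
- have -> : 2 * p = Y^-1 by rewrite /p; field; rewrite gt_eqF.
  rewrite exprVn ler_pdivrMr ?exprn_gt0//.
  apply: (@le_trans _ _ (q * L%:R)).
    apply: (@le_trans _ _ (A0 * s + 2)).
      by rewrite -natr1; lra.
    have : A0 * s <= A0 / k * L%:R.
      by rewrite -mulrA [k^-1 * _]mulrC ler_wpM2l.
    have : 1 <= L%:R :> R by rewrite ler1n.
    rewrite /q => ? ?; lra.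
  have YL : L%:R * q * w * expR (a * s) <= Y ^+ L.
    rewrite /Y !exprMn; apply: ler_pM; rewrite ?expR_ge0//.
    + by rewrite !mulr_ge0//; lra.
    + apply: ler_pM; [by rewrite mulr_ge0//; lra|lra| |by apply: ler_eXnr].
      apply: ler_pM; [by []|lra| |by apply: ler_eXnr => //; lra].
      by rewrite -natrX ler_nat ltnW// ltn_expl.
    + rewrite -expRM_natr ler_expR -mulrA ler_wpM2l ?(ltW a0)//.
      by rewrite mulrC.
  have -> : q * L%:R = expR (- (a * s)) / w * (L%:R * q * w * expR (a * s)).
    rewrite expRN; field; rewrite (gt_eqF w0)/=.
    by rewrite gt_eqF// expR_gt0.
  by apply: ler_wpM2l YL; rewrite divr_ge0 ?expR_ge0// ltW.
- move=> x1.
  have sce : s <= c / e.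
    rewrite ler_pdivlMr//; move: x1; rewrite /x ltr_pdivrMr// mul1r mulrC.
    exact: ltW.
  have dl0 : 0 <= dl2 by rewrite /dl2 !divr_ge0 ?expR_ge0// ltW.
  have MM : M%:R <= A0 * (c / e) + 1.
    by apply: le_trans MA _; rewrite lerD2r ler_wpM2l.
  have MD : M%:R * M%:R * (C * s) <= D.
    rewrite /D; apply: ler_pM.
    - exact: mulr_ge0.
    - by apply: mulr_ge0; exact: ltW.
    - by rewrite expr2; apply: ler_pM.
    - by rewrite ler_pM2l.
  apply: (@le_trans _ _ (D * dl2)).
    rewrite [X in X <= _](_ : _ = M%:R * M%:R * (C * s) * Num.min dl1 dl2); last by ring.
    apply: ler_pM => //; last by rewrite ge_min lexx orbT.
      by do 2 apply: mulr_ge0 => //; exact: ltW.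
    rewrite le_min dl0 andbT /dl1 !divr_ge0//; last exact: ltW.
    by apply: mulr_ge0; [exact: ltW|rewrite exprn_ge0// ltW].
  rewrite /dl2 mulrC divfK ?gt_eqF//.
  apply: ler_wpM2r; first by rewrite invr_ge0 ltW.
  by rewrite ler_expR lerN2 ler_pM2l.
Qed.

(** * The union bound at a fixed index *)

Section Deviation.
Variables (R : realType) (N d : nat) (dO : measure_display) (Omega : measurableType dO).
Variable (P : probability Omega R).
Variables (eta0 : Omega -> site N d -> bool) (tau : nat -> Omega -> R)
          (U : nat -> Omega -> site N d * site N d).
Variables (n : R) (phi : 'I_d -> bool -> 'rV[R]_d -> R) (F T s c z h0 Mb : R).
Variables (M : nat) (eps del h : nat -> R).

Let X w t := collision_pairing eta0 tau U n phi w t.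
Let x j := eps j * s / c.
Let L j := window_length (x j).

(** The deterministic half: fewer than [M] rings up to [T] bound the path and the number of windows
    to inspect, and the other excluded events give the gaps that [jump_path_modulus] asks for. *)
Lemma good_path_modulus w : 0 < T -> 0 < s -> 0 < c -> 0 <= F ->
  (forall l b y, `|phi l b (@edge_midpoint R N d y l b)| <= F) ->
  2 * d%:R * F * collision_weight N d n = c / s -> c / s * M%:R <= Mb ->
  (forall j, 0 < eps j) -> (forall j, 0 < del j) -> 0 < h0 -> (forall j, 0 < h j) ->
  2 * T <= M%:R * h0 -> (forall j, 2 * del j <= (L j)%:R * h j) ->
  (forall j, 0 <= tau j w) -> ~ window_event tau 0 M h0 w ->
  (forall j i, (i <= M)%N -> ~ window_event tau i (L j) (h j) w) ->
  (forall j i, x j < 1 -> (i < M)%N ->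
    ~ end_event tau i (Num.trunc (T / del j)).+1 T (del j) w) ->
  modulus_set T Mb eps del (X w).
Proof.
move=> T0 s0 c0 F0 phiF cE MbE eps0 del0 h00 hp TM delh t0 nW0 nW nE.
set J := jump_time tau w.
have J0 : J 0%N = 0 by rewrite /J jump_time0.
have Jnd k : J k <= J k.+1 by rewrite /J jump_timeS lerDl.
have JM : T < J M.
  rewrite ltNge; apply/negP => JT; apply: nW0; apply: (@window_eventP _ _ _ tau 0 M h0 T) => //.
pose S k := collision_observable n phi (chain eta0 U w k).
have XE : X w = fun t => S (ring_count J t).
  by apply/funext => t; rewrite /X collision_pairingE.
have Slip i j : (i <= j)%N -> `|S j - S i| <= c / s * (j - i)%:R.
  by move=> ij; rewrite -cE; exact: chain_lipschitz.
have S0 : S 0%N = 0.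
  rewrite /S /collision_observable /= big1// => l _; rewrite big1// => b _.
  by rewrite big1// => y _; rewrite mulr0 mul0r.
have cs0 : 0 < c / s by rewrite divr_gt0.
split.
- exact: collision_pairing_right_continuous.
- move=> t tT; rewrite XE; have [_ _ kM] := ring_count_bounds J0 Jnd JM tT.
  have := Slip 0%N _ (leq0n (ring_count J t)); rewrite S0 !subr0 subn0.
  move=> /le_trans; apply; apply: le_trans MbE.
  by rewrite ler_pM2l// ler_nat ltnW.
- move=> j; rewrite XE.
  have xr r : (eps j < c / s * r%:R) = (x j < r%:R).
    by rewrite /x ltr_pdivrMr// mulrAC ltr_pdivlMr// [c * _]mulrC.
  have x0 : 0 < x j by rewrite /x !divr_gt0// mulr_gt0.
  apply: (@jump_path_modulus R J S T M (c / s) (eps j) (del j) (L j)) => //.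
  + by rewrite /L /window_length leq_max.
  + move=> r; rewrite xr => xjr; rewrite /L /window_length geq_max; apply/andP; split.
      by rewrite -(ltr_nat R) (lt_trans x0 xjr).
    by rewrite ltnW// truncn_lt_nat// ltW.
  + move=> i iM; rewrite leNgt; apply/negP => /ltW Jdl; apply: (nW j i iM).
    by apply: (@window_eventP _ _ _ tau i (L j) (h j) (del j)) => //; rewrite -jump_time_window.
  + have [xj1|xj1] := ltP (x j) 1.
      right => -[//|i] iM Ji; apply: (nE j i xj1 iM).
      apply: end_eventP => //.
      by rewrite -ltr_pdivrMr// truncnS_gt.
    left => r; rewrite xr => xjr; rewrite /L /window_length.
    have t1 : (0 < Num.trunc (x j))%N by rewrite truncn_gt0.
    by rewrite (maxn_idPr t1) truncn_lt_nat// ltW.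
Qed.

Variable Q : set {ffun site N d -> bool}.
Let E : set Omega := [set w | Q [ffun y => eta0 w y]].

Lemma not_modulus_set_le (rate C p0 : R) (p : nat -> R) :
  (forall i A, gen_events eta0 tau U i A -> measurable A) ->
  mutually_independent P eta0 tau U ->
  (forall j B, measurable B -> P (tau j @^-1` B) = exponential_prob rate B) ->
  0 <= rate -> rate <= C * s -> 0 < C ->
  0 < T -> 0 < s -> 0 < c -> 0 <= F ->
  (forall l b y, `|phi l b (@edge_midpoint R N d y l b)| <= F) ->
  2 * d%:R * F * collision_weight N d n = c / s -> c / s * M%:R <= Mb ->
  (forall j, 0 < eps j) -> (forall j, 0 < del j) ->
  0 < p0 <= 1 -> (forall j, 0 < p j <= 1) ->
  0 <= z -> h0 = p0 ^+ 2 / (C * s) -> (forall j, h j = p j ^+ 2 / (C * s)) ->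
  2 * T <= M%:R * h0 -> (forall j, 2 * del j <= (L j)%:R * h j) ->
  (2 * p0) ^+ M <= z / 2 ->
  (forall j, M.+1%:R * (2 * p j) ^+ L j <= z / (2 ^ j.+3)%:R) ->
  (forall j, x j < 1 -> M%:R * (C * s * (M%:R * del j)) <= z / (2 ^ j.+3)%:R) ->
  measurable [set w | ~ modulus_set T Mb eps del (X w)] /\
  (P ([set w | ~ modulus_set T Mb eps del (X w)] `&` E) <= (fine (P E) * z)%:E)%E.
Proof.
move=> gen_meas indep exp_law rate0 rateC C0 T0 s0 c0 F0 phiF cE MbE eps0 del0.
move=> /andP[p00 p01] pp z0 h0E hE TM delh W0 Wj Ej.
have mE : measurable E by exact: (measurable_eta0 gen_meas Q).
have mX : measurable [set w | ~ modulus_set T Mb eps del (X w)].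
  by apply: measurableC; exact: measurable_modulus_set.
split => //.
have Cs0 : 0 < C * s by rewrite mulr_gt0.
have hle q : rate * (q ^+ 2 / (C * s)) <= q ^+ 2.
  rewrite mulrCA ler_piMr ?sqr_ge0//; first by rewrite ler_pdivrMr// mul1r.
have h00 : 0 < h0 by rewrite h0E divr_gt0// exprn_gt0.
have hp j : 0 < h j.
  by have /andP[? _] := pp j; rewrite hE divr_gt0// exprn_gt0.
pose Neg j := tau j @^-1` `]-oo, 0[.
have Negle j : rel_le P E (Neg j) 0.
  have mN : measurable (Neg j) by exact: (measurable_tau_preimage gen_meas).
  split => //; have -> : (fine (P E) * 0)%:E = P (Neg j).
    by rewrite mulr0 (tau_neg_null exp_law).
  exact: measureIr.
pose m j := (Num.trunc (T / del j)).+1.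
(* [V 0] carries [z / 2] for too many rings; [V j.+1] carries [z / 2 ^ j.+2] for level [j], half for
   windows and half for end events. The weights sum to [z], and each [V j] also takes one null event
   [Neg j]. *)
pose V j := if j is j'.+1 then
    (\big[setU/set0]_(i < M.+1) window_event tau i (L j') (h j')) `|`
    (\big[setU/set0]_(i < M | x j' < 1) end_event tau i (m j') T (del j')) `|` Neg j
  else window_event tau 0 M h0 `|` Neg 0%N.
have V_le j : rel_le P E (V j) (z / (2 ^ j.+1)%:R).
  case: j => [|j] /=.
    rewrite -[z / _]addr0; apply: rel_leU => //.
    apply: (rel_le_weak W0); apply: (window_event_le gen_meas indep Q rate0 exp_law).
      by rewrite ltW.
    exact: ltW.
    by rewrite h0E hle.
  have -> : z / (2 ^ j.+2)%:R = z / (2 ^ j.+3)%:R + z / (2 ^ j.+3)%:R + 0.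
    rewrite addr0 [in RHS]expnS natrM; field.
    by rewrite pnatr_eq0 expn_eq0.
  apply: rel_leU => //; apply: rel_leU => //.
    apply: (@rel_le_weak _ _ _ _ _ _ (\sum_(i < M.+1) (2 * p j) ^+ L j)).
      by rewrite sumr_const card_ord -[leLHS]mulr_natl.
    apply: rel_le_bigU => // i _.
    have /andP[pj0 pj1] := pp j.
    apply: (window_event_le gen_meas indep Q rate0 exp_law).
    + by rewrite ltW.
    + exact: ltW.
    + by rewrite hE hle.
  have [xj|xj] := ltP (x j) 1; last first.
    rewrite big_pred0_eq; apply: (@rel_le_weak _ _ _ _ _ _ 0); last exact: rel_le0.
    by rewrite divr_ge0.
  apply: (@rel_le_weak _ _ _ _ _ _ (\sum_(i < M) C * s * (M%:R * del j))).
    by rewrite sumr_const card_ord -[leLHS]mulr_natl; exact: Ej.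
  apply: rel_le_bigU => // i _.
  apply: (@rel_le_weak _ _ _ _ _ _ (rate * (i.+1%:R * del j))).
    apply: ler_pM => //; first by rewrite mulr_ge0// ltW.
    by rewrite ler_pM2r// ler_nat.
  exact: (end_event_le gen_meas indep Q rate0 exp_law).
have sub : [set w | ~ modulus_set T Mb eps del (X w)] `&` E `<=` \bigcup_j (E `&` V j).
  move=> w [nX Ew]; apply: contrapT => nV; apply: nX.
  have {}nV j : ~ V j w by move=> Vw; apply: nV; exists j.
  have nN j : ~ Neg j w by move=> Nw; apply: (nV j); rewrite /V; case: j Nw; right.
  apply: good_path_modulus => //.
  - by move=> j; rewrite leNgt; apply/negP => tj; apply: (nN j); rewrite /Neg/= in_itv.
  - by move=> Ww; apply: (nV 0%N); left.
  - move=> j i iM Ww; apply: (nV j.+1); left; left.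
    by rewrite (bigD1 (Ordinal (iM : (i < M.+1)%N)))//=; left.
  - move=> j i xj iM Ww; apply: (nV j.+1); left; right.
    by rewrite (bigD1 (Ordinal iM))//=; left.
have mV j : measurable (E `&` V j) by apply: measurableI => //; case: (V_le j).
apply: le_trans (measure_sigma_subadditive P mV _ sub) _; first exact: measurableI.
apply: le_trans (epsilon_trick0 xpredT _); last first.
  by rewrite mulr_ge0// fine_prob_ge0.
apply: lee_nneseries => [*|j *]; first exact: measure_ge0.
by rewrite -mulrA; case: (V_le j).
Qed.

End Deviation.

Lemma limn_esup_le_cst (R : realType) (u : (\bar R)^nat) (l : \bar R) :
  (forall k, (u k <= l)%E) -> (limn_esup u <= l)%E.
Proof.
move=> ul; apply: (@le_trans _ _ (ereal_sup (range u))).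
  by apply: ereal_inf_lbound; exists setT => //; exact: filterT.
by apply: ge_ereal_sup => _ [k _ <-].
Qed.

Lemma elog_rate_le (R : realType) (s a r : R) : 0 < s -> 0 <= r ->
  r <= expR (- (a * s)) -> (s^-1%:E * elog r%:E <= (- a)%:E)%E.
Proof.
move=> s0 r0 rz; rewrite /elog; case: ifPn => [_|].
  by rewrite gt0_muleNy ?leNye// lte_fin invr_gt0.
rewrite eqe => rn0; have rp : 0 < r by rewrite lt_neqAle eq_sym rn0.
rewrite /= -EFinM lee_fin -ler_pdivlMl ?invr_gt0// invrK.
have := rz; rewrite -ler_ln ?posrE ?expR_gt0// expRK => /le_trans; apply.
by rewrite mulrN mulrC.
Qed.

(** Only an inequality, since directions and signs can yield the same ordered pair when [N <= 2]. *)
Lemma card_Edges_le N d : (#|Edges N d| <= 2 * d * N ^ d)%N.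
Proof.
pose f (q : site N d * 'I_d * bool) := (q.1.1, lattice_shift q.1.1 q.1.2 q.2).
apply: (@leq_trans #|[set f q | q in [set: site N d * 'I_d * bool]]%SET|).
  apply: subset_leq_card; apply/fintype.subsetP => -[x y]; rewrite inE/=.
  move=> /existsP[l /existsP[s /eqP yE]]; apply/imsetP; exists (x, l, s).
    by rewrite finset.in_setT.
  by rewrite yE.
apply: leq_trans (leq_imset_card _ _) _; rewrite cardsT !card_prod card_ffun !card_ord card_bool.
by rewrite -mulnA mulnC [(d * 2)%N]mulnC.
Qed.

Lemma collision_speedE (R : realType) (N d : nat) (alpha n : R) : (0 < N)%N ->
  n = alpha / (N%:R^-1) ^+ d ->
  N%:R^-1 ^+ d * n ^+ 2 / N%:R^-1 ^+ 2 = alpha ^+ 2 * (N%:R ^+ d * N%:R ^+ 2).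
Proof.
move=> N0 ->; have u0 : N%:R != 0 :> R by rewrite pnatr_eq0 -lt0n.
have : N%:R ^+ d != 0 :> R by rewrite expf_neq0.
rewrite exprVn; move: (N%:R ^+ d) => v v0.
by field; rewrite u0 v0.
Qed.

Unset Implicit Arguments.
Set Strict Implicit.

Theorem theorem5p4 (R : realType) (d : nat) (T alpha : R)
    (rho0 : 'rV[R]_d -> R) (phi : 'I_d -> bool -> 'rV[R]_d -> R)
    (N n : nat -> nat)
    (dO : nat -> measure_display) (Omega : forall k, measurableType (dO k))
    (P : forall k, probability (Omega k) R)
    (eta0 : forall k, Omega k -> site (N k) d -> bool)
    (tau : forall k, nat -> Omega k -> R)
    (U : forall k, nat -> Omega k -> site (N k) d * site (N k) d) :
  (0 < d)%N -> 0 < T -> 0 < alpha < 1 ->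
  (* rho0 in C(T^d), nonnegative *)
  continuous rho0 -> Zd_periodic rho0 -> (forall x, 0 <= rho0 x) ->
  (* eps_k = 1 / N_k, 1/eps_k in N, eps_k -> 0 *)
  (forall k, (0 < N k)%N) -> ((N k)%:R^-1 : R) @[k --> \oo] --> 0 ->
  (* classic scaling n = alpha / eps^d *)
  (forall k, (n k)%:R = alpha / ((N k)%:R^-1) ^+ d) ->
  (* n int_{B_eps(x)} rho0 <= 1 *)
  (forall k (x : site (N k) d), bern_param (n k)%:R rho0 x <= 1) ->
  (* the k-th exclusion process with collision counts *)
  (forall k, is_model (P k) (eta0 k) (tau k) (U k) (n k)%:R rho0) ->
  (* phi in C^infty(T^d x {1..d} x {+,-}) *)
  (forall l s, smooth (phi l s) /\ Zd_periodic (phi l s)) ->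
  forall a : R, 0 < a ->
  exists K : set (R -> R),
    J1compact T K /\
    (limn_esup (fun k =>
        let eps : R := ((N k)%:R^-1)%R in
        let speed : R := (eps ^+ d * (n k)%:R ^+ 2 / eps ^+ 2)%R in
        let X : Omega k -> R -> R :=
          fun w t => collision_pairing (eta0 k) (tau k) (U k) (n k)%:R%R phi w t in
        let E : set (Omega k) :=
          [set w | empirical_TV (eta0 k) (n k)%:R%R w = L1_torus rho0] in
        (speed^-1)%R%:E * elog (cond_prob (P k) E [set w | ~ K (X w)]))
      <= (- a)%:E)%E.
Proof.
move=> d0 T0 /andP[alpha0 _] _ _ _ N0 _ nE _ model phis a a0.
have /choice[Fl FlP] : forall ls : 'I_d * bool, exists F : R, 0 <= F /\
    forall N (x : site N d) (l : 'I_d) s, (0 < N)%N ->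
      `|phi ls.1 ls.2 (edge_midpoint R x l s)| <= F.
  move=> [l b]; have [F F0 HF] := @edge_midpoint_bounded R d (phi l b) (((phis l b).1 [::]).1).
  by exists F.
(* The summand 1 keeps [F], and hence the jump constant [c], positive even for [phi = 0]. *)
pose F := 1 + \sum_ls Fl ls.
have sumF : 0 <= \sum_ls Fl ls by apply: sumr_ge0 => ls _; case: (FlP ls).
have F0 : 0 < F by rewrite /F; lra.
have phiF k l b y : `|phi l b (@edge_midpoint R (N k) d y l b)| <= F.
  have [_ /(_ (N k) y l b (N0 k)) H] := FlP (l, b); apply: le_trans H _.
  rewrite /F (bigD1 (l, b))//=.
  have : 0 <= \sum_(i | i != (l, b)) Fl i by apply: sumr_ge0 => ls _; case: (FlP ls).
  by move=> ?; lra.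
pose c := 2 * d%:R * F.
have d0R : 0 < d%:R :> R by rewrite ltr0n.
have c0 : 0 < c by rewrite /c !mulr_gt0.
have al20 : 0 < alpha ^+ 2 by rewrite exprn_gt0.
(* The clock rate is at most [2 * d * N ^ (d + 2)], while the speed is [alpha ^ 2 * N ^ (d + 2)]. *)
pose C := 2 * d%:R / alpha ^+ 2.
have C0 : 0 < C by rewrite /C divr_gt0// mulr_gt0.
(* Then [(2 * p0) ^+ M = (expR (- a) / 2) ^+ M <= expR (- (a * s)) / 2] as soon as [M >= s] and
   [M >= 1]. *)
pose p0 := expR (- a) / 4.
have ea0 : 0 < expR (- a) by exact: expR_gt0.
have ea1 : expR (- a) <= 1 by rewrite expR_le1; lra.
have p00 : 0 < p0 by rewrite /p0; lra.
have p01 : p0 <= 1 by rewrite /p0; lra.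
have p020 : 0 < p0 ^+ 2 by rewrite exprn_gt0.
(* With [M >= A0 * s], the summand 1 gives [M >= s] and the other gives
   [2 * T <= M%:R * (p0 ^+ 2 / (C * s))]. *)
pose A0 := 1 + 2 * T * C / p0 ^+ 2.
have A01 : 1 <= A0.
  rewrite /A0 lerDl; apply: divr_ge0; last exact: ltW.
  by rewrite mulr_ge0 ?(ltW C0)// mulr_ge0 ?(ltW T0).
have A00 : 0 <= A0 by lra.
pose eps (j : nat) : R := j.+1%:R^-1.
have eps0 j : 0 < eps j by rewrite invr_gt0.
have /choice[pd pdP] : forall j, exists pd : R * R, [/\ 0 < pd.1 <= 1, 0 < pd.2 &
    forall (s : R) (M : nat), 0 < s -> M%:R <= A0 * s + 1 ->
    [/\ 2 * pd.2 <= (window_length (eps j * s / c))%:R * (pd.1 ^+ 2 / (C * s)),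
        M.+1%:R * (2 * pd.1) ^+ window_length (eps j * s / c)
          <= expR (- (a * s)) / (2 ^ j.+3)%:R &
        eps j * s / c < 1 ->
        M%:R * (C * s * (M%:R * pd.2)) <= expR (- (a * s)) / (2 ^ j.+3)%:R]].
  move=> j; have [p [dl H]] := deviation_constants j a0 C0 c0 A00 (eps0 j).
  by exists (p, dl).
(* Bounds [M <= A0 * s + 1] jumps of size [c / s], using [s >= alpha ^ 2]. *)
pose Mb := c * A0 + c / alpha ^+ 2.
exists (modulus_set T Mb eps (fun j => (pd j).2)); split.
  apply: modulus_set_compact => //.
    move=> e e0; exists (Num.trunc e^-1); rewrite /eps invf_plt ?posrE//.
    exact: truncnS_gt.
  by move=> j; case: (pdP j).
apply: limn_esup_le_cst => k /=.
set s := (_ / _); set E := [set w | _ = _].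
have sE : s = alpha ^+ 2 * ((N k)%:R ^+ d * (N k)%:R ^+ 2) by exact: collision_speedE.
have N1 : 1 <= (N k)%:R :> R by rewrite ler1n.
have NN1 : 1 <= (N k)%:R ^+ d * (N k)%:R ^+ 2 :> R.
  by rewrite -exprD exprn_ege1.
have sal : alpha ^+ 2 <= s by rewrite sE ler_pMr.
have s0 : 0 < s by exact: lt_le_trans sal.
pose M := (Num.trunc (A0 * s)).+1.
have A0s : 0 <= A0 * s by rewrite mulr_ge0// ltW.
have MA : A0 * s <= M%:R by rewrite ltW// truncnS_gt.
have MA' : M%:R <= A0 * s + 1.
  by rewrite /M -natr1 lerD2r truncn_le.
have sM : s <= M%:R by apply: le_trans MA; rewrite ler_peMl// ltW.
have [gen_meas _ exp_law _ indep] := model k.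
(* The conditioning event is expressed through the initial configuration alone, which makes it
   independent of the clocks. *)
pose Q : set {ffun site (N k) d -> bool} :=
  [set e : {ffun site (N k) d -> bool} |
    \sum_(x : site (N k) d) `|(n k)%:R^-1 * (e x)%:R| = L1_torus rho0].
have EQ : E = [set w | Q [ffun x => eta0 k w x]].
  apply/seteqP; split => w; rewrite /E /Q /= /empirical_TV => <-;
    by apply: eq_bigr => x _; rewrite ffunE.
have rateC : rate_total R (N k) d <= C * s.
  rewrite /rate_total sE /C.
  apply: (@le_trans _ _ ((N k)%:R ^+ 2 * (2 * d * N k ^ d)%:R)).
    by rewrite ler_wpM2l ?exprn_ge0// ler_nat card_Edges_le.
  rewrite !natrM natrX le_eqVlt; apply/orP; left; apply/eqP; field.
  by rewrite gt_eqF.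
pose K := modulus_set T Mb eps (fun j => (pd j).2).
pose X w t := collision_pairing (eta0 k) (tau k) (U k) (n k)%:R phi w t.
have [mK PK] : measurable [set w | ~ K (X w)] /\
    (P k ([set w | ~ K (X w)] `&` E) <= (fine (P k E) * expR (- (a * s)))%:E)%E.
  rewrite EQ; apply: (@not_modulus_set_le R (N k) d _ _ (P k)
    (eta0 k) (tau k) (U k) (n k)%:R phi F T s c (expR (- (a * s))) (p0 ^+ 2 / (C * s)) Mb
    M eps (fun j => (pd j).2) (fun j => (pd j).1 ^+ 2 / (C * s)) Q
    (rate_total R (N k) d) C p0 (fun j => (pd j).1) gen_meas indep exp_law) => //.
  - by rewrite /rate_total mulr_ge0// exprn_ge0.
  - exact: ltW.
  - by rewrite /c /s /collision_weight invf_div.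
  - rewrite /Mb; apply: (@le_trans _ _ (c / s * (A0 * s + 1))).
      by rewrite ler_pM2l// divr_gt0.
    have -> : c / s * (A0 * s + 1) = c * A0 + c / s by field; rewrite gt_eqF.
    by rewrite lerD2l ler_pM2l// lef_pV2.
  - by move=> j; case: (pdP j).
  - by rewrite p00.
  - by move=> j; case: (pdP j).
  - apply: (@le_trans _ _ (A0 * s * (p0 ^+ 2 / (C * s)))); last first.
      by rewrite ler_pM2r// divr_gt0// mulr_gt0.
    have -> : A0 * s * (p0 ^+ 2 / (C * s)) = p0 ^+ 2 / C + 2 * T.
      rewrite /A0; field; rewrite (gt_eqF C0) (gt_eqF s0) /=.
      by rewrite gt_eqF.
    by rewrite lerDr divr_ge0// ltW.
  - by move=> j; have [_ _ /(_ s M s0 MA')[]] := pdP j.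
  - have -> : 2 * p0 = expR (- a) / 2 by rewrite /p0; field.
    rewrite expr_div_n; apply: ler_pM.
    + exact: exprn_ge0 (ltW ea0).
    + by rewrite invr_ge0 exprn_ge0.
    + by rewrite -expRM_natr ler_expR mulNr lerN2 ler_pM2l.
    + by rewrite lef_pV2 ?posrE ?exprn_gt0//; apply: ler_eXnr => //; lra.
  - by move=> j; have [_ _ /(_ s M s0 MA')[]] := pdP j.
  - by move=> j; have [_ _ /(_ s M s0 MA')[]] := pdP j.
have mE : measurable E by rewrite EQ; exact: (measurable_eta0 gen_meas Q).
rewrite /cond_prob; apply: elog_rate_le => //.
  by rewrite divr_ge0// fine_prob_ge0.
(* A null conditioning event gives conditional probability 0, because the inverse of 0 is 0. *)
have [PE0|PE0] := eqVneq (fine (P k E)) 0.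
  by rewrite PE0 invr0 mulr0 expR_ge0.
rewrite ler_pdivrMr ?lt_neqAle ?(eq_sym 0) ?PE0 ?fine_prob_ge0// mulrC.
by rewrite -lee_fin fine_prob//; exact: measurableI.
Qed.
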